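(* There exists a universal constant $K>0$ such that the following holds. Let $(\Sigma,d)$ be a compact metric space, and let $\beta\ge 0$, $\varphi\ge 1$ be such that for all $r\in(0,1]$ the number of open balls of radius at most $r$ needed to cover $\Sigma$ is at most $\varphi r^{-\beta}$. Let $X=(X_i)_{i\ge1}$ be a Markov chain on $(\Sigma,\mathcal B(\Sigma))$ with starting law $\mathcal V$ and transition kernel $\mathfrak P(x,dy)$, having a unique invariant probability measure $\Pi$, and such that $\mathcal V(dy)=\nu(y)\,\Pi(dy)$ and $\mathfrak P(x,dy)=p(x,y)\,\Pi(dy)$ for all $x\in\Sigma$. Assume that there are $\kappa>0$ and $\gamma\in(0,1]$ with $|p(x,z)-p(x,z')|\le\kappa\, d(z,z')^{\gamma}$ for all $x,z,z'\in\Sigma$, and that there is $\varepsilon\in(0,\tfrac12]$ with $\sup_{x,y\in\Sigma}|p(x,y)-1|\le\varepsilon$ and $\sup_{x\in\Sigma}|\nu(x)-1|\le\varepsilon$. Let $Y=(Y_i)_{i\ge1}$ be i.i.d. with law $\Pi$. Then, for all $n\ge1$, $$\mathrm d_{\mathrm{TV}}(L_n^X,L_n^Y)\le K\varepsilon\sqrt{1+\ln(\varphi 2^{\beta})+\frac{\beta}{\gamma}\ln\Big(\frac{\kappa\vee(2\varepsilon)}{\varepsilon}\Big)}.$$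
   Context: For a process $Z=(Z_j)_{j\ge1}$ on $\Sigma$, the local time field at time $n$ is $L_n^Z=(L_n^Z(x))_{x\in\Sigma}$ with $L_n^Z(x)=\sum_{j=1}^n \mathbf 1_{\{Z_j=x\}}$. It is identified with the random $n$-point counting measure $\sum_{j=1}^n\delta_{Z_j}$ on $\Sigma$, a random element of the space of $n$-point measures $m$ on $\Sigma$ endowed with the $\sigma$-algebra generated by the maps $m\mapsto m(B)$, $B\in\mathcal B(\Sigma)$. For random elements $U,V$ with values in the same measurable space, $\mathrm d_{\mathrm{TV}}(U,V)=\sup_A|\mathbb P[U\in A]-\mathbb P[V\in A]|$, the supremum being over measurable sets $A$. $a\vee b=\max(a,b)$. ''Universal'' means not depending on any of the data. *)

(* Defs.v *)
From HB Require Import structures.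
From mathcomp Require Import all_boot all_order all_algebra finmap.
From mathcomp Require Import all_classical all_reals all_analysis measurable_realfun.

Set Implicit Arguments.
Unset Strict Implicit.
Unset Printing Implicit Defensive.

Import Order.TTheory GRing.Theory Num.Theory.
Import numFieldNormedType.Exports.

Local Open Scope classical_set_scope.
Local Open Scope ring_scope.

(* No compatibility between the two structures is built in: that the
   sigma-algebra is the Borel one is a separate hypothesis.  measurableType
   carries a base point, which is harmless as soon as S carries a probability
   measure. *)
#[short(type="measurableMetricType")]
HB.structure Definition MeasurableMetric (d : measure_display) (R : realType) :=
  {S of Metric R S & Measurable d S}.

Definition covering_number (R : realType) (S : metricType R) (r : R) : \bar R :=
  ereal_inf [set N%:R%:E | N in
    [set N : nat | exists (c : 'I_N -> S) (rho : 'I_N -> R),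
      (forall i, 0 < rho i <= r) /\
      [set: S] `<=` \bigcup_(i : 'I_N) ball (c i) (rho i)]].

Section markov_chains.
Context {d : measure_display} {S : measurableType d} {R : realType}.
Local Open Scope ereal_scope.

Definition has_density (mu Pi : {measure set S -> \bar R}) (f : S -> R) :=
  measurable_fun [set: S] f /\
  forall A, measurable A -> mu A = \int[Pi]_(x in A) (f x)%:E.

Definition invariant (k : R.-pker S ~> S) (Q : probability S R) :=
  forall A, measurable A -> \int[Q]_x k x A = Q A.

Definition unique_invariant (k : R.-pker S ~> S) (Pi : probability S R) :=
  invariant k Pi /\
  forall Q : probability S R, invariant k Q ->
    forall A, measurable A -> Q A = Pi A.

Context {dW : measure_display} {W : measurableType dW} (P : probability W R).

(* Processes are indexed from 0: X i stands for the (i+1)-st variable.  The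
   Markov property is P[X_n+1 in A | X_0, ..., X_n] = k(X_n, A), with the
   conditional probability given by its defining property, E ranging over the
   sigma-algebra generated by X_0, ..., X_n. *)
Definition markov_chain (V : probability S R) (k : R.-pker S ~> S)
    (X : nat -> {RV P >-> S}) :=
  (forall A, measurable A -> distribution P (X 0%N) A = V A) /\
  forall (n : nat) (E : set W) (A : set S),
    g_sigma_preimage (fun i : 'I_n.+1 => X i : W -> S) E -> measurable A ->
    P (E `&` X n.+1 @^-1` A) = \int[P]_(w in E) k (X n w) A.

Definition mutually_independent (Y : nat -> {RV P >-> S}) :=
  forall (J : {fset nat}) (A : nat -> set S),
    (forall i, i \in J -> measurable (A i)) ->
    P (\bigcap_(i in [set` J]) Y i @^-1` A i) =
    \prod_(i <- J) P (Y i @^-1` A i).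

Definition iid (Pi : probability S R) (Y : nat -> {RV P >-> S}) :=
  mutually_independent Y /\
  forall i A, measurable A -> distribution P (Y i) A = Pi A.

End markov_chains.

Section point_measures.
Context {d : measure_display} (S : measurableType d) (R : realType) (n : nat).
Local Open Scope ereal_scope.

Record point_measure := PointMeasure {
  point_measure_val :> {measure set S -> \bar R};
  point_measureP : exists z : 'I_n -> S,
    forall B, measurable B -> point_measure_val B = \sum_(i < n) \d_(z i) B }.

HB.instance Definition _ := gen_eqMixin point_measure.
HB.instance Definition _ := gen_choiceMixin point_measure.

Lemma sum_diracP (z : nat -> S) : exists y : 'I_n -> S,
  forall B, measurable B ->
    msum (fun i => \d_(z i) : {measure set S -> \bar R}) n B =
    \sum_(i < n) \d_(y i) B.
Proof. by exists (fun i : 'I_n => z i). Qed.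

Definition sum_dirac (z : nat -> S) : point_measure :=
  PointMeasure (sum_diracP z).

HB.instance Definition _ := isPointed.Build point_measure (sum_dirac (fun=> point)).

Definition evaluations : set (set point_measure) :=
  \bigcup_(B in @measurable d S)
    preimage_set_system setT (fun m : point_measure => m B)
      (measurable : set (set \bar R)).

Definition point_measure_space : measurableType evaluations.-sigma :=
  g_sigma_algebraType evaluations.

End point_measures.

Section local_times.
Context {d dW : measure_display} {S : measurableType d} {W : measurableType dW}.
Context {R : realType} {P : probability W R}.

Definition local_time (n : nat) (Z : nat -> {RV P >-> S}) (w : W) :
    point_measure_space S R n := sum_dirac R n (fun j => Z j w).

Lemma measurable_local_time n Z : measurable_fun setT (local_time n Z).
Proof.
apply: (@measurability _ _ W (point_measure_space S R n) setT (local_time n Z)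
  (@evaluations d S R n)) => //.
move=> _ [_ [B mB [C mC <-]] <-]; rewrite !setTI.
have mf : measurable_fun setT
    (fun w => \sum_(j < n) (\1_B (Z j w))%:E : \bar R)%E.
  apply: emeasurable_sum => j.
  apply/measurable_EFinP.
  by apply: (@measurableT_comp _ _ _ _ _ _ (\1_B : S -> R) _ (Z j)).
by have := mf measurableT C mC; rewrite setTI.
Qed.

HB.instance Definition _ n Z := isMeasurableFun.Build _ _ _ _
  (local_time n Z) (@measurable_local_time n Z).

End local_times.

Definition dTV (dE d1 d2 : measure_display) (E : measurableType dE)
    (W1 : measurableType d1) (W2 : measurableType d2) (R : realType)
    (P1 : probability W1 R) (U : {RV P1 >-> E})
    (P2 : probability W2 R) (V : {RV P2 >-> E}) : \bar R :=
  ereal_sup [set `|distribution P1 U A - distribution P2 V A|%E | A in measurable].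

Arguments markov_chain {d S R dW W} P V k X.
Arguments mutually_independent {d S R dW W} P Y.
Arguments iid {d S R dW W} P Pi Y.
Arguments dTV {dE d1 d2 E W1 W2 R} P1 U P2 V.

(* Main.v *)
Require Import Defs.
From HB Require Import structures.
From mathcomp Require Import all_boot all_order all_algebra finmap.
From mathcomp Require Import all_classical all_reals all_analysis.
From mathcomp Require Import measurable_realfun ring lra zify.

(** The distance is at most [289 * eps]; the square root is at least 1.

    The law of [(X_1, ..., X_n)] has density [nu * prod (1 + eps h)] with
    respect to the law of [(Y_1, ..., Y_n)], where, by invariance of [Pi], the
    kernel [h] integrates to zero in each of its two arguments.  Expanding this
    product, and stopping at the first factor [1] after the first factor
    [eps h], writes the difference of the two laws as a sum of terms
    [eps^l * (run of l factors h)], with i.i.d. points before the run and a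
    stationary Markov chain after it.  A functional of the local time field does
    not see the order of the points, so the two end points of the run may be
    averaged over all the points that are independent of the rest; since [h] is
    degenerate, the summands of this average are orthogonal, and with [2f] such
    points it is O(1/f).  Because the transition densities are at least [1/2],
    the Markov part also provides a number of free points proportional to its
    length.  Each of the O(n) positions of the run thus costs O(eps/n).

    This is done for finite state spaces.  The chain is reduced to one by a
    finite partition of [S] on whose cells both arguments of the transition
    density hardly matter; averaging over the cells keeps [h] exactly
    degenerate.  Events on the local time field are approximated by events on
    the finite chain. *)

Set Implicit Arguments.
Unset Strict Implicit.
Unset Printing Implicit Defensive.

Import Order.TTheory GRing.Theory Num.Theory.
Import numFieldNormedType.Exports.

Local Open Scope classical_set_scope.
Local Open Scope ring_scope.

(** * Functionals of finite chains *)

(** Stands in for the Cauchy-Schwarz inequality: it bounds a first moment by a second moment with a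
    free weight [c]. *)
Lemma amgm_weighted (R : realFieldType) (c z : R) : 0 < c ->
  z <= 2^-1 * (c^-1 * z ^+ 2 + c).
Proof.
move=> c0; rewrite -subr_ge0.
have -> : 2^-1 * (c^-1 * z ^+ 2 + c) - z = (2 * c)^-1 * (z - c) ^+ 2.
  by field; rewrite gt_eqF.
by rewrite mulr_ge0 ?sqr_ge0// invr_ge0 mulr_ge0// ltW.
Qed.

Section finite_state_space.
Context {R : realType} {T : finType} (pi : T -> R).

(** The weight [b] may be signed or unnormalised, so that one functional serves both the transition
    density and the degenerate kernel [h]. The starting point [x] is not part of the sequence passed
    to [f]. *)
Fixpoint markovE (b : T -> T -> R) (n : nat) (x : T) (f : seq T -> R) : R :=
  if n is m.+1 then
    \sum_y pi y * b x y * markovE b m y (fun s => f (y :: s))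
  else f [::].

Fixpoint iidE (n : nat) (f : seq T -> R) : R :=
  if n is m.+1 then \sum_x pi x * iidE m (fun s => f (x :: s)) else f [::].

Definition statE (b : T -> T -> R) (n : nat) (f : seq T -> R) : R :=
  if n is m.+1 then \sum_x pi x * markovE b m x (fun s => f (x :: s))
  else f [::].

Definition seq_symmetric (A : Type) (f : seq T -> A) :=
  forall s t, perm_eq s t -> f s = f t.

Definition linear_functional (F : (seq T -> R) -> R) :=
  forall (I : Type) (r : seq I) (c : I -> R) (f : I -> seq T -> R),
    F (fun s => \sum_(i <- r) c i * f i s) = \sum_(i <- r) c i * F (f i).

Lemma sym_cons f x : @seq_symmetric R f -> seq_symmetric (fun s => f (x :: s)).
Proof. by move=> fS s t st; apply: fS; rewrite perm_cons. Qed.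

Lemma sym_catr f u : @seq_symmetric R f -> seq_symmetric (fun s => f (s ++ u)).
Proof. by move=> fS s t st; apply: fS; rewrite perm_cat2r. Qed.

Lemma markovE_linear b n x : linear_functional (markovE b n x).
Proof.
move=> I r c f; elim: n x f => [//|n IHn] x f /=.
under eq_bigr => y _ do rewrite (IHn y (fun i s => f i (y :: s))) mulr_sumr.
rewrite exchange_big /=; apply: eq_bigr => i _; rewrite mulr_sumr.
by apply: eq_bigr => y _; rewrite mulrCA.
Qed.

Lemma iidE_markovE n x : iidE n = markovE (fun _ _ => 1) n x.
Proof.
apply/funext => f; elim: n x f => //= n IHn x f.
by apply: eq_bigr => y _; rewrite mulr1 (IHn y).
Qed.

Lemma iidES n f :
  iidE n.+1 f = \sum_x pi x * iidE n (fun s => f (x :: s)).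
Proof. by []. Qed.

Lemma iidE_linear n : linear_functional (iidE n).
Proof.
move=> I r c f; elim: n f => [//|n IHn] f /=.
under eq_bigr => y _ do rewrite (IHn (fun i s => f i (y :: s))) mulr_sumr.
rewrite exchange_big /=; apply: eq_bigr => i _; rewrite mulr_sumr.
by apply: eq_bigr => y _; rewrite mulrCA.
Qed.

Lemma statE_linear b n : linear_functional (statE b n).
Proof.
case: n => [//|n] I r c f /=.
under eq_bigr => y _ do
  rewrite (markovE_linear b n y r c (fun i s => f i (y :: s))) mulr_sumr.
rewrite exchange_big /=; apply: eq_bigr => i _; rewrite mulr_sumr.
by apply: eq_bigr => y _; rewrite mulrCA.
Qed.

Lemma linear_functionalZ F c f : linear_functional F ->
  F (fun s => c * f s) = c * F f.
Proof.
move=> FL; have := FL _ [:: tt] (fun=> c) (fun=> f).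
rewrite big_seq1 => <-; congr F; apply/funext => s.
by rewrite big_seq1.
Qed.

Lemma linear_functionalD F f g : linear_functional F ->
  F (fun s => f s + g s) = F f + F g.
Proof.
move=> FL.
have := FL _ [:: true; false] (fun=> 1) (fun b => if b then f else g).
rewrite !big_cons !big_nil !mul1r addr0 => <-; congr F; apply/funext => s.
by rewrite !big_cons !big_nil !mul1r addr0.
Qed.

(** All these expectations are finite weighted sums, so Fubini reduces to linearity of the outer
    functional. *)
Lemma markovE_swap F b n x (G : seq T -> seq T -> R) : linear_functional F ->
  F (fun s => markovE b n x (G s)) =
  markovE b n x (fun t => F (fun s => G s t)).
Proof.
move=> FL; elim: n x G => [//|n IHn] x G /=.
by rewrite FL; apply: eq_bigr => y _; rewrite IHn.
Qed.

Lemma iidE_swap F n (G : seq T -> seq T -> R) : linear_functional F ->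
  F (fun s => iidE n (G s)) = iidE n (fun t => F (fun s => G s t)).
Proof.
move=> FL; elim: n G => [//|n IHn] G /=.
by rewrite FL; apply: eq_bigr => y _; rewrite IHn.
Qed.

Lemma statE_swap F b n (G : seq T -> seq T -> R) : linear_functional F ->
  F (fun s => statE b n (G s)) = statE b n (fun t => F (fun s => G s t)).
Proof.
move=> FL; case: n => [//|n] /=.
by rewrite FL; apply: eq_bigr => y _; rewrite markovE_swap.
Qed.

Lemma iidE_cat m n f :
  iidE (m + n) f = iidE m (fun s => iidE n (fun t => f (s ++ t))).
Proof.
elim: m f => [//|m IHm] f /=.
by apply: eq_bigr => x _; rewrite IHm.
Qed.

Hypothesis pi_ge0 : forall x, 0 <= pi x.
Hypothesis pi_sum1 : \sum_x pi x = 1.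

Lemma pi_average_le (f : T -> R) (M : R) : (forall x, `|f x| <= M) ->
  `|\sum_x pi x * f x| <= M.
Proof.
move=> fM; rewrite (le_trans (ler_norm_sum _ _ _))//.
rewrite -[leRHS]mul1r -pi_sum1 mulr_suml ler_sum// => x _.
by rewrite normrM ger0_norm// ler_wpM2l.
Qed.

Lemma markovE_bound b n x f (M : R) : (forall x, \sum_y pi y * `|b x y| <= 1) ->
  (forall s, `|f s| <= M) -> `|markovE b n x f| <= M.
Proof.
move=> b1; elim: n x f => [|n IHn] x f fM //=.
have M0 : 0 <= M by exact: le_trans (fM [::]).
rewrite (le_trans (ler_norm_sum _ _ _))//.
rewrite (@le_trans _ _ ((\sum_y pi y * `|b x y|) * M))//; last exact: ler_piMl.
rewrite mulr_suml ler_sum// => y _.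
by rewrite !normrM (ger0_norm (pi_ge0 _)) ler_wpM2l ?mulr_ge0// IHn.
Qed.

Lemma iidE_bound n f (M : R) : (forall s, `|f s| <= M) -> `|iidE n f| <= M.
Proof.
elim: n f => [|n IHn] f fM //=.
by apply: pi_average_le => x; exact: IHn.
Qed.

Lemma iidE_le n f g : (forall s, f s <= g s) -> iidE n f <= iidE n g.
Proof.
elim: n f g => [|n IHn] f g fg //=.
by apply: ler_sum => x _; rewrite ler_wpM2l// IHn.
Qed.

Lemma iidE_cst n c : iidE n (fun=> c) = c.
Proof. by elim: n => //= n ->; rewrite -mulr_suml pi_sum1 mul1r. Qed.

(** By exchangeability each of the [n.+1] points contributes equally to the sum, so the marked point
    can be brought to the front. *)
Lemma iidE_sum_sym n (a : T -> R) f : seq_symmetric f ->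
  iidE n.+1 (fun s => (\sum_(x <- s) a x) * f s) =
  n.+1%:R * \sum_x pi x * (a x * iidE n (fun s => f (x :: s))).
Proof.
elim: n f => [|n IHn] f fS.
  rewrite mul1r /=; apply: eq_bigr => x _.
  by rewrite big_seq1.
have -> : iidE n.+2 (fun s => (\sum_(x <- s) a x) * f s) =
    \sum_x pi x * (a x * iidE n.+1 (fun s => f (x :: s))) +
    \sum_x pi x * iidE n.+1 (fun s => (\sum_(z <- s) a z) * f (x :: s)).
  rewrite iidES; set F := iidE n.+1; rewrite -big_split/=.
  apply: eq_bigr => x _; rewrite -mulrDr /F; congr (_ * _).
  rewrite -linear_functionalZ; last exact: iidE_linear.
  rewrite -linear_functionalD; last exact: iidE_linear.
  by congr iidE; apply/funext => s; rewrite big_cons mulrDl.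
rewrite -[n.+2]addn1 natrD mulrDl mul1r addrC; congr (_ + _).
under eq_bigr => x _ do rewrite (IHn _ (sym_cons x fS)) mulrCA.
rewrite -mulr_sumr; congr (_ * _).
under eq_bigr => x _ do rewrite mulr_sumr.
rewrite exchange_big /=; apply: eq_bigr => z _.
rewrite !mulr_sumr; apply: eq_bigr => x _.
rewrite mulrCA; congr (_ * _); rewrite mulrCA; congr (_ * (_ * _)).
congr iidE; apply/funext => s; apply: fS.
by rewrite -[x :: z :: s]/([:: x; z] ++ s) -[z :: x :: s]/([:: z; x] ++ s)
  perm_cat2r; apply/permP => p /=; rewrite addnCA.
Qed.

Lemma iidE_sum_mean0 n (a : T -> R) : \sum_x pi x * a x = 0 ->
  iidE n (fun s => \sum_(x <- s) a x) = 0.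
Proof.
move=> a0; case: n => [|n]; first by rewrite /= big_nil.
have := @iidE_sum_sym n a (fun=> 1) (fun _ _ _ => erefl).
under eq_fun do rewrite mulr1.
move=> ->; under eq_bigr do rewrite iidE_cst mulr1.
by rewrite a0 mulr0.
Qed.

(** The variance of a sum of independent centred variables: the cross terms vanish. *)
Lemma iidE_sum_sqr n (a : T -> R) : \sum_x pi x * a x = 0 ->
  iidE n (fun s => (\sum_(x <- s) a x) ^+ 2) = n%:R * \sum_x pi x * a x ^+ 2.
Proof.
move=> a0; elim: n => [|n IHn]; first by rewrite /= big_nil mul0r expr0n.
rewrite /=.
have E x : iidE n (fun s => (\sum_(z <- x :: s) a z) ^+ 2) =
    iidE n (fun=> a x ^+ 2) + iidE n (fun s => (\sum_(z <- s) a z) ^+ 2).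
  have Z0 : iidE n (fun s => 2 * a x * \sum_(z <- s) a z) = 0.
    rewrite linear_functionalZ; last exact: iidE_linear.
    by rewrite iidE_sum_mean0// mulr0.
  rewrite -[RHS]addr0 -[X in _ + X]Z0 -!linear_functionalD;
    [|exact: iidE_linear..].
  by congr iidE; apply/funext => s; rewrite big_cons; ring.
under eq_bigr do rewrite E iidE_cst mulrDr.
by rewrite big_split/= -mulr_suml pi_sum1 IHn -natr1; ring.
Qed.

Definition degenerate (H : T -> T -> R) :=
  [/\ forall x y, `|H x y| <= 1, forall x, \sum_y pi y * H x y = 0 &
      forall y, \sum_x pi x * H x y = 0].

(* Symmetry spreads H over all (f+1)^2 pairs of points, and these terms are
   pairwise orthogonal. *)
Lemma degenerate_pair_bound H f phi : degenerate H -> seq_symmetric phi ->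
  (forall s, `|phi s| <= 1) ->
  `|\sum_x pi x * \sum_y pi y * (H x y *
      iidE f.*2 (fun s => phi (x :: y :: s)))| <= f.+1%:R^-1.
Proof.
move=> [H1 Hr Hl] phiS phi1; set I := (X in `|X|).
pose Z u v := \sum_(x <- u) \sum_(y <- v) H x y.
(* Exchangeability is applied once in [u] and once in [v], each time with a factor [f.+1]. *)
have E1 : iidE f.+1 (fun u => iidE f.+1 (fun v => Z u v * phi (u ++ v))) =
    f.+1%:R ^+ 2 * I.
  rewrite iidE_swap; last exact: iidE_linear.
  under eq_fun => v do rewrite (iidE_sum_sym _ _ (sym_catr v phiS)).
  rewrite linear_functionalZ; last exact: iidE_linear.
  rewrite expr2 -mulrA; congr (_ * _).
  rewrite iidE_linear /I [RHS]mulr_sumr; apply: eq_bigr => x _.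
  rewrite mulrCA; congr (_ * _).
  under eq_fun => v do
    (rewrite -linear_functionalZ; last exact: iidE_linear).
  rewrite iidE_swap; last exact: iidE_linear.
  have S1 u : seq_symmetric (fun v => phi ((x :: u) ++ v)).
    by move=> s t st; apply: phiS; rewrite perm_cat2l.
  under eq_fun => u do rewrite (iidE_sum_sym _ _ (S1 u)).
  rewrite linear_functionalZ; last exact: iidE_linear.
  congr (_ * _); rewrite iidE_linear; apply: eq_bigr => y _; congr (_ * _).
  rewrite linear_functionalZ; last exact: iidE_linear.
  rewrite -addnn iidE_cat; congr (_ * iidE _ _); apply/funext => u.
  congr iidE; apply/funext => v; apply: phiS.
  by rewrite cat_cons perm_cons -cat1s perm_catCA.
(* Orthogonality in [u] uses that [H] is centred in its first argument, orthogonality in [v] that it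
   is centred in its second. *)
have E2 : iidE f.+1 (fun u => iidE f.+1 (fun v => Z u v ^+ 2)) <= f.+1%:R ^+ 2.
  rewrite iidE_swap; last exact: iidE_linear.
  have Z0 v : \sum_x pi x * \sum_(y <- v) H x y = 0.
    under eq_bigr do rewrite mulr_sumr.
    by rewrite exchange_big/= big1.
  under eq_fun => v do rewrite iidE_sum_sqr//.
  rewrite linear_functionalZ; last exact: iidE_linear.
  rewrite iidE_linear expr2 ler_wpM2l//.
  rewrite (le_trans (ler_norm _))//; apply: pi_average_le => x.
  rewrite iidE_sum_sqr// normrM ger0_norm// ler_piMr//.
  apply: pi_average_le => y.
  by rewrite normrX expr_le1.
(* The weight [f.+1] balances the two terms of the weighted inequality: after division by it, the
   second moment is also at most [f.+1]. *)
have E3 : `|f.+1%:R ^+ 2 * I| <= f.+1%:R.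
  rewrite -E1; apply: (@le_trans _ _ (iidE f.+1 (fun u => iidE f.+1 (fun v =>
    2^-1 * (f.+1%:R^-1 * Z u v ^+ 2 + f.+1%:R))))).
    have N g : `|iidE f.+1 g| <= iidE f.+1 (fun s => `|g s|).
      rewrite ler_norml -mulN1r -linear_functionalZ; last exact: iidE_linear.
      apply/andP; split; apply: iidE_le => s; last exact: ler_norm.
      by rewrite mulN1r lerNnormlW.
    rewrite (le_trans (N _))//; apply: iidE_le => u.
    rewrite (le_trans (N _))//; apply: iidE_le => v.
    rewrite normrM (le_trans (ler_piMr _ (phi1 _)))//.
    by rewrite -(real_normK (num_real (Z u v))) amgm_weighted// ltr0n.
  under eq_fun => u do (rewrite linear_functionalZ; last exact: iidE_linear).
  rewrite linear_functionalZ; last exact: iidE_linear.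
  under eq_fun => u do (rewrite linear_functionalD; last exact: iidE_linear).
  under eq_fun => u do rewrite iidE_cst.
  rewrite linear_functionalD; last exact: iidE_linear.
  rewrite iidE_cst.
  under eq_fun => u do (rewrite linear_functionalZ; last exact: iidE_linear).
  rewrite linear_functionalZ; last exact: iidE_linear.
  have p0 : 0 < f.+1%:R :> R by rewrite ltr0n.
  move: E2; have /ler_pM2l <- : 0 < f.+1%:R^-1 :> R by rewrite invr_gt0.
  rewrite expr2 mulKf ?gt_eqF// => E2.
  by rewrite ler_pdivrMl ?ltr0n// mulrDl mul1r lerD2r.
have p0 : 0 < f.+1%:R :> R by rewrite ltr0n.
move: E3; rewrite normrM ger0_norm ?exprn_ge0// => E3.
rewrite -(ler_pM2l (exprn_gt0 2 p0)) (le_trans E3)// expr2 -mulrA.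
by rewrite mulfV ?mulr1// gt_eqF.
Qed.

(** Freezing the interior point [y] turns [H x y * h y z] into a kernel in [(x, z)] that is again
    bounded by 1 and degenerate, so the run shortens by one. The first kernel [H] is arbitrary in
    order to carry this induction. *)
Lemma degenerate_run_bound h l H f phi : degenerate h -> degenerate H ->
  seq_symmetric phi -> (forall s, `|phi s| <= 1) ->
  `|\sum_x pi x * \sum_y pi y * (H x y * markovE h l y (fun s =>
      iidE f.*2 (fun t => phi (x :: y :: s ++ t))))| <= f.+1%:R^-1.
Proof.
move=> hD; elim: l H phi => [|l IHl] H phi HD phiS phi1.
  exact: degenerate_pair_bound.
rewrite (_ : \sum_x _ = \sum_y pi y * (\sum_x pi x * \sum_z pi z *
   (H x y * h y z * markovE h l z (fun s =>
      iidE f.*2 (fun t => phi (y :: x :: z :: s ++ t)))))).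
  apply: pi_average_le => y.
  apply: (IHl (fun x z => H x y * h y z) (fun s => phi (y :: s))); last by [].
    case: hD HD => h1 hr hl [H1 Hr Hl]; split => [x z|x|z].
    - by rewrite normrM mulr_ile1.
    - by under eq_bigr do rewrite mulrCA; rewrite -mulr_sumr hr mulr0.
    - by under eq_bigr do rewrite mulrA; rewrite -mulr_suml Hl mul0r.
  exact: sym_cons.
under eq_bigr do rewrite mulr_sumr.
rewrite exchange_big/=; apply: eq_bigr => y _.
rewrite mulr_sumr; apply: eq_bigr => x _.
rewrite mulrCA; congr (_ * (_ * _)); rewrite !mulr_sumr; apply: eq_bigr => z _.
rewrite -!mulrA mulrCA; congr (_ * (_ * (_ * _))).
congr markovE; apply/funext => s.
congr iidE; apply/funext => t; apply: phiS.
by rewrite -[x :: y :: _]/([:: x; y] ++ _) -[y :: x :: _]/([:: y; x] ++ _)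
  perm_cat2r; apply/permP => p /=; rewrite addnCA.
Qed.

End finite_state_space.

(** * Regeneration for transition densities bounded below *)

Section doubly_stochastic.
Context {R : realType} {T : finType} (pi : T -> R).
Hypothesis pi_ge0 : forall x, 0 <= pi x.
Hypothesis pi_sum1 : \sum_x pi x = 1.
Variable b : T -> T -> R.
Hypothesis b_half : forall x y, 2^-1 <= b x y.
Hypothesis b_row : forall x, \sum_y pi y * b x y = 1.

Lemma markovE_bound_b n x f (M : R) : (forall s, `|f s| <= M) ->
  `|markovE pi b n x f| <= M.
Proof.
apply: markovE_bound => // z; rewrite -(b_row z) le_eqVlt; apply/orP; left.
apply/eqP; apply: eq_bigr => y _; rewrite ger0_norm//.
by rewrite (le_trans _ (b_half z y))// invr_ge0.
Qed.

Lemma average_affine u c x : \sum_y pi y * (u * b x y - c) = u - c.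
Proof.
under eq_bigr => y _ do rewrite mulrBr mulrCA.
by rewrite sumrB -mulr_sumr b_row mulr1 -mulr_suml pi_sum1 mul1r.
Qed.

(* Three consecutive transitions dominate 1/8 times the product law, so with
   probability 1/8 the block creates two fresh i.i.d. points and restarts from
   [pi]; the bound 16/(M+16f+14) is preserved by this recursion. *)
Lemma markovE_regeneration M r w f (psi : seq T -> R) : seq_symmetric psi ->
  (forall f' u, `|iidE pi f'.*2 (fun t => psi (t ++ u))| <= f'.+1%:R^-1) ->
  `|markovE pi b (r + M * 3) w
     (fun u => iidE pi f.*2 (fun t => psi (t ++ u)))| <=
  16 / (M%:R + 16 * f%:R + 14).
Proof.
elim: M w f psi => [|M IHM] w f psi psiS psiB.
  (* Without blocks the [r] leftover steps are just frozen, and only the [f.*2] points already free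
     are used. *)
  apply: (@le_trans _ _ f.+1%:R^-1); first exact: markovE_bound_b.
  have f0 : 0 <= f%:R :> R by [].
  rewrite add0r -natr1 ler_pdivlMr ?ler_pdivrMl; lra.
have eight : (8^-1 = 2^-1 * 2^-1 * 2^-1 :> R) by field.
have b8 x y z : 8^-1 <= b w x * (b x y * b y z).
  rewrite mulrA eight ler_pM ?ler_pM ?mulr_ge0//; lra.
have -> : (r + M.+1 * 3 = (r + M * 3).+3)%N by lia.
set m := (r + M * 3)%N.
pose G x y z := markovE pi b m z
  (fun u => iidE pi f.*2 (fun t => psi (t ++ x :: y :: z :: u))).
have -> : markovE pi b m.+3 w
    (fun u => iidE pi f.*2 (fun t => psi (t ++ u))) =
  8^-1 * (\sum_z pi z * \sum_x pi x * \sum_y pi y * G x y z) +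
  \sum_x pi x * \sum_y pi y * \sum_z pi z *
    ((b w x * (b x y * b y z) - 8^-1) * G x y z).
  have -> : \sum_z pi z * (\sum_x pi x * \sum_y pi y * G x y z) =
      \sum_x pi x * \sum_y pi y * \sum_z pi z * G x y z.
    under eq_bigr do rewrite mulr_sumr.
    rewrite exchange_big/=; apply: eq_bigr => x _; rewrite mulr_sumr.
    under eq_bigr do rewrite !mulr_sumr.
    rewrite exchange_big/=; apply: eq_bigr => y _.
    rewrite !mulr_sumr; apply: eq_bigr => z _.
    by rewrite mulrCA; congr (_ * _); rewrite mulrCA.
  rewrite mulr_sumr -big_split/=; apply: eq_bigr => x _.
  rewrite mulrCA -mulrDr -mulrA; congr (_ * _).
  rewrite !mulr_sumr -big_split/=; apply: eq_bigr => y _.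
  rewrite [_ * (pi y * _)]mulrCA -mulrDr -!mulrA mulrCA; congr (_ * _).
  rewrite !mulr_sumr -big_split/=; apply: eq_bigr => z _.
  rewrite /G; set g := markovE _ _ _ _ _.
  ring.
have psiS3 x y z : seq_symmetric (fun s => psi (x :: y :: z :: s)).
  by move=> s t st; apply: psiS; rewrite !perm_cons.
have GB x y z : `|G x y z| <= 16 / (M%:R + 16 * f%:R + 14).
  have -> : G x y z = markovE pi b m z (fun u => iidE pi f.*2
      (fun t => (fun s => psi (x :: y :: z :: s)) (t ++ u))).
    congr markovE; apply/funext => u; congr iidE; apply/funext => t.
    by apply: psiS; rewrite (perm_catCA t [:: x; y; z]).
  apply: (IHM z f _ (psiS3 x y z)) => f' u.
  have := psiB f' [:: x, y, z & u]; congr (`|_| <= _).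
  congr iidE; apply/funext => t; apply: psiS.
  by rewrite (perm_catCA t [:: x; y; z]).
(* In the regenerated part [x] and [y] join the free points and the chain restarts from [z]: [f]
   grows by one while [M] drops by one. *)
have GB' : `|\sum_z pi z * \sum_x pi x * \sum_y pi y * G x y z| <=
    16 / (M%:R + 16 * f.+1%:R + 14).
  apply: (pi_average_le pi_ge0 pi_sum1) => z.
  rewrite (_ : \sum_x _ = markovE pi b m z (fun u => iidE pi f.+1.*2
      (fun t => (fun s => psi (z :: s)) (t ++ u)))).
    apply: (IHM z f.+1 _ (sym_cons z psiS)) => f' u.
    have := psiB f' (z :: u); congr (`|_| <= _).
    congr iidE; apply/funext => t; apply: psiS.
    by rewrite (perm_catCA t [:: z]).
  transitivity (\sum_x pi x * markovE pi b m z (fun u => \sum_y pi y *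
      iidE pi f.*2 (fun t => psi (t ++ x :: y :: z :: u)))).
    by apply: eq_bigr => x _; rewrite markovE_linear.
  rewrite -markovE_linear; congr markovE; apply/funext => u.
  rewrite doubleS !iidES; apply: eq_bigr => x _; congr (_ * _).
  rewrite iidES; apply: eq_bigr => y _; congr (_ * _).
  congr iidE; apply/funext => t; apply: psiS.
  rewrite (perm_catCA t [:: x; y; z] u) /=.
  by apply/permP => p /=; rewrite !addnA; congr (_ + _)%N; lia.
(* The remaining density is nonnegative with total mass 7/8; on it only [M] drops, with no new free
   points. *)
have R1 : `|\sum_x pi x * \sum_y pi y * \sum_z pi z *
    ((b w x * (b x y * b y z) - 8^-1) * G x y z)| <=
   7 / 8 * (16 / (M%:R + 16 * f%:R + 14)).
  have -> : 7 / 8 = \sum_x pi x * \sum_y pi y * \sum_z pi z *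
    (b w x * (b x y * b y z) - 8^-1).
    under eq_bigr => x _.
      under eq_bigr => y _.
        under eq_bigr => z _ do rewrite mulrA.
        rewrite average_affine; over.
      rewrite average_affine -[b w x]mul1r; over.
    by rewrite average_affine; field.
  rewrite mulr_suml (le_trans (ler_norm_sum _ _ _))// ler_sum// => x _.
  rewrite normrM ger0_norm// -mulrA ler_wpM2l//.
  rewrite mulr_suml (le_trans (ler_norm_sum _ _ _))// ler_sum// => y _.
  rewrite normrM ger0_norm// -mulrA ler_wpM2l//.
  rewrite mulr_suml (le_trans (ler_norm_sum _ _ _))// ler_sum// => z _.
  rewrite normrM ger0_norm// -mulrA ler_wpM2l//.
  by rewrite normrM ger0_norm ?subr_ge0// ler_wpM2l ?subr_ge0.
have R0 : `|8^-1 * \sum_z pi z * \sum_x pi x * \sum_y pi y * G x y z| <=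
    8^-1 * (16 / (M%:R + 16 * f.+1%:R + 14)).
  by rewrite normrM ger0_norm ?invr_ge0// ler_wpM2l// ?invr_ge0.
apply: (le_trans (ler_normD _ _)); apply: (le_trans (lerD R0 R1)).
have f0 : 0 <= f%:R :> R by [].
have M0 : 0 <= M%:R :> R by [].
rewrite -(natr1 f) -(natr1 M).
set v := M%:R + 16 * f%:R + 14 : R.
have v14 : 14 <= v by rewrite /v; lra.
have -> : M%:R + 16 * (f%:R + 1) + 14 = v + 16 :> R by rewrite /v; ring.
have -> : M%:R + 1 + 16 * f%:R + 14 = v + 1 :> R by rewrite /v; ring.
rewrite -subr_ge0.
(* The gap has the sign of [v - 14], which explains the constant 14 in the bound. *)
have -> : 16 / (v + 1) - (8^-1 * (16 / (v + 16)) + 7 / 8 * (16 / v)) =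
   16 * (v - 14) / (v * (v + 1) * (v + 16)).
  by field; apply/and3P; split; apply: lt0r_neq0; lra.
by rewrite divr_ge0 ?mulr_ge0//; lra.
Qed.

(** The [a] independent points are paired, an odd one being frozen, and the chain is cut into blocks
    of three steps after its first point. The constant 48 is 16 times the block length. *)
Lemma statE_regeneration a m (psi : seq T -> R) : seq_symmetric psi ->
  (forall f' u, `|iidE pi f'.*2 (fun t => psi (t ++ u))| <= f'.+1%:R^-1) ->
  `|iidE pi a (fun t => statE pi b m (fun u => psi (t ++ u)))| <=
  48 / (a + m + 1)%:R.
Proof.
move=> psiS psiB; rewrite -{1}(odd_double_half a) iidE_cat.
set f := a./2.
have S q : seq_symmetric (fun s => psi (q ++ s)).
  by move=> s t st; apply: psiS; rewrite perm_cat2l.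
have B q f' u : `|iidE pi f'.*2 (fun t => psi (q ++ t ++ u))| <= f'.+1%:R^-1.
  have := psiB f' (q ++ u); congr (`|_| <= _); congr iidE; apply/funext => t.
  by apply: psiS; rewrite perm_catCA.
apply: iidE_bound => // q.
have fa : 2 * f%:R + 1 >= a%:R :> R.
  by rewrite -natrM natr1 ler_nat /f; lia.
have a0 : 0 <= a%:R :> R by [].
have f0 : 0 <= f%:R :> R by [].
case: m => [|m].
  have := B q f [::]; under eq_fun do rewrite cats0.
  under [in X in _ -> X]eq_fun do rewrite /= cats0.
  move=> /le_trans; apply.
  rewrite addn0 natrD -natr1 ler_pdivlMr; last lra.
  rewrite ler_pdivrMl; lra.
rewrite [X in `|X|](_ : _ = \sum_z pi z * markovE pi b m z (fun u =>
   iidE pi f.*2 (fun t => psi ((z :: q) ++ t ++ u)))).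
  apply: (@le_trans _ _ (16 / ((m %/ 3)%:R + 16 * f%:R + 14))).
    apply: (pi_average_le pi_ge0 pi_sum1) => z.
    rewrite [in markovE _ _ m](divn_eq m 3) [(_ * 3 + _)%N]addnC.
    by apply: (markovE_regeneration _ _ _ _ (S (z :: q))) => f' u; exact: B.
  have M3 : 3 * (m %/ 3)%:R + 2 >= m%:R :> R.
    by rewrite -natrM -natrD ler_nat; lia.
  have m0 : 0 <= (m %/ 3)%:R :> R by [].
  rewrite ler_pdivrMr; last lra.
  rewrite mulrAC ler_pdivlMr; last by rewrite ltr0n; lia.
  rewrite !natrD -natr1; lra.
rewrite [in LHS]/= iidE_linear; apply: eq_bigr => z _; congr (_ * _).
rewrite markovE_swap; last exact: iidE_linear.
congr markovE; apply/funext => u; congr iidE; apply/funext => t.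
by apply: psiS; apply/permP => P; rewrite /= !count_cat/=; lia.
Qed.

End doubly_stochastic.

(** The infinite series sums to 6; the induction is on the closed form of its tail. *)
Lemma sum_arith_geometric (R : realFieldType) n :
  \sum_(i < n) (i%:R + 2) * 2^-1 ^+ i <= 6 :> R.
Proof.
suff -> : \sum_(i < n) (i%:R + 2) * 2^-1 ^+ i =
    6 - (n%:R + 3) * (2 * 2^-1 ^+ n) :> R.
  by rewrite gerBl !mulr_ge0 ?exprn_ge0 ?addr_ge0// invr_ge0.
elim: n => [|n IHn]; first by rewrite big_ord0 expr0 /=; ring.
by rewrite big_ord_recr/= IHn exprS -natr1; field.
Qed.

(** * Comparison with the i.i.d. law on a finite state space *)

Section perturbed_iid.
Context {R : realType} {T : finType} (pi : T -> R).
Hypothesis pi_ge0 : forall x, 0 <= pi x.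
Hypothesis pi_sum1 : \sum_x pi x = 1.
Variables (b h : T -> T -> R) (eps : R).
Hypothesis eps_gt0 : 0 < eps.
Hypothesis eps_half : eps <= 2^-1.
Hypothesis h_degenerate : degenerate pi h.
Hypothesis bE : forall x y, b x y = 1 + eps * h x y.

Let b_half x y : 2^-1 <= b x y.
Proof.
have [h1 _ _] := h_degenerate.
have : `|eps * h x y| <= eps.
  by rewrite normrM gtr0_norm// ler_piMr// ltW.
by rewrite ler_norml bE => /andP[+ _]; move: (eps * _) eps_half => z ? ?; lra.
Qed.

Let b_row x : \sum_y pi y * b x y = 1.
Proof.
have [_ hr _] := h_degenerate.
under eq_bigr do rewrite bE mulrDr mulr1 mulrCA.
by rewrite big_split/= -mulr_sumr hr mulr0 addr0.
Qed.

(* Expand the product of the [1 + eps * h]; [l] is the number of factors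
   [eps * h] that precede the first factor [1]. *)
Lemma markovE_expansion n x f : markovE pi b n x f =
  \sum_(l < n.+1) eps ^+ l * markovE pi h l x (fun s =>
    statE pi b (n - l) (fun t => f (s ++ t))).
Proof.
elim: n x f => [|n IHn] x f; first by rewrite big_ord1 mul1r.
rewrite big_ord_recl/= mul1r.
under eq_bigr => y _ do rewrite bE mulrDr mulr1 mulrDl.
rewrite big_split/=; congr (_ + _).
under eq_bigr => y _ do rewrite IHn mulr_sumr.
rewrite exchange_big/=; apply: eq_bigr => l _.
rewrite mulr_sumr; apply: eq_bigr => y _.
by rewrite /bump/= add1n subSS exprS; ring.
Qed.

(** The term without any factor [eps * h] is an independent point followed by a fresh stationary
    chain. Iterating on that term makes the points i.i.d. one at a time; the other terms are
    errors. *)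
Lemma statE_expansion n f : statE pi b n.+1 f =
  \sum_x pi x * statE pi b n (fun s => f (x :: s)) +
  \sum_(l < n) eps ^+ l.+1 * \sum_x pi x * markovE pi h l.+1 x (fun s =>
    statE pi b (n - l.+1) (fun t => f (x :: s ++ t))).
Proof.
rewrite [LHS]/=.
under eq_bigr => x _ do rewrite markovE_expansion big_ord_recl mulrDr.
rewrite big_split; congr (_ + _).
  by apply: eq_bigr => x _; rewrite /= mul1r subn0.
under eq_bigr => x _ do rewrite mulr_sumr.
rewrite exchange_big; apply: eq_bigr => l _.
rewrite mulr_sumr; apply: eq_bigr => x _.
by rewrite lift0 mulrCA.
Qed.

(** Integrating out the run first leaves a symmetric functional [psi] of the other points. The run
    bound for [h] is precisely the decay in the number of free points that regeneration asks of
    [psi]. *)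
Lemma statE_run_bound a m l phi : seq_symmetric phi ->
  (forall s, `|phi s| <= 1) ->
  `|iidE pi a (fun s0 => \sum_x pi x * markovE pi h l.+1 x (fun s =>
    statE pi b m (fun t => phi (s0 ++ x :: s ++ t))))| <=
  48 / (a + m + 1)%:R.
Proof.
move=> phiS phi1.
pose psi w := \sum_x pi x * markovE pi h l.+1 x (fun s => phi (x :: s ++ w)).
rewrite [X in `|X|](_ : _ =
    iidE pi a (fun s0 => statE pi b m (fun t => psi (s0 ++ t)))).
  apply: statE_regeneration => // [s t st|f u].
    rewrite /psi; apply: eq_bigr => x _; congr (_ * markovE _ _ _ _ _).
    by apply/funext => s'; apply: phiS; rewrite perm_cons perm_cat2l.
  rewrite [X in `|X|](iidE_linear pi f.*2 (index_enum T) pi).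
  have -> : \sum_x pi x * iidE pi f.*2 (fun t => markovE pi h l.+1 x (fun s =>
        phi (x :: s ++ t ++ u))) =
      \sum_x pi x * \sum_y pi y * (h x y * markovE pi h l y (fun s =>
        iidE pi f.*2 (fun t => phi ((x :: y :: s ++ t) ++ u)))).
    apply: eq_bigr => x _; congr (_ * _).
    rewrite markovE_swap; last exact: iidE_linear.
    rewrite /=; apply: eq_bigr => y _; rewrite -mulrA; congr (_ * (_ * _)).
    congr markovE; apply/funext => s; congr iidE; apply/funext => t.
    by rewrite /= catA.
  by apply: (degenerate_run_bound pi_ge0 pi_sum1 l f h_degenerate h_degenerate
    (sym_catr u phiS)).
congr iidE; apply/funext => s0; rewrite statE_linear.
apply: eq_bigr => x _; congr (_ * _).
rewrite -statE_swap; last exact: markovE_linear.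
congr markovE; apply/funext => s; congr statE; apply/funext => t.
by apply: phiS; rewrite -cat_cons perm_catCA.
Qed.

(** A long run leaves few points to average over, but its factor [eps ^+ l], at most [2^-1 ^+ l],
    more than compensates. The constant 288 is 48 times the sum 6 of the series. *)
Lemma sum_run_bound n N : (n < N)%N ->
  \sum_(l < n) eps ^+ l.+1 * (48 / (N - l.+1)%:R) <= 288 * eps / N%:R.
Proof.
move=> nN.
have N0 : 0 < N%:R :> R by rewrite ltr0n; lia.
apply: (@le_trans _ _ (\sum_(l < n)
    48 * eps / N%:R * ((l%:R + 2) * 2^-1 ^+ l))); last first.
  rewrite -mulr_sumr.
  apply: (le_trans (ler_wpM2l _ (sum_arith_geometric R n))).
    by rewrite !mulr_ge0 ?invr_ge0// ltW.
  by rewrite le_eqVlt; apply/orP; left; apply/eqP; field; rewrite gt_eqF.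
apply: ler_sum => l _.
have ln := ltn_ord l.
have Nl : 0 < (N - l.+1)%:R :> R by rewrite ltr0n; lia.
have e0 := ltW eps_gt0.
have D1 : (N - l.+1)%:R^-1 <= (l%:R + 2) / N%:R :> R.
  rewrite ler_pdivlMr// ler_pdivrMl// -natrD -natrM ler_nat.
  have [k ->] : exists k, N = (l.+2 + k)%N by exists (N - l.+2)%N; lia.
  by rewrite (_ : (_ - _)%N = k.+1); [nia|lia].
have -> : eps ^+ l.+1 * (48 / (N - l.+1)%:R) =
    48 * eps * (eps ^+ l * (N - l.+1)%:R^-1) by rewrite exprS; ring.
have -> : 48 * eps / N%:R * ((l%:R + 2) * 2^-1 ^+ l) =
    48 * eps * (2^-1 ^+ l * ((l%:R + 2) / N%:R)) by ring.
rewrite ler_wpM2l ?mulr_ge0//.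
apply: ler_pM; rewrite ?exprn_ge0 ?invr_ge0//.
by rewrite lerXn2r// nnegrE invr_ge0.
Qed.

(** Each step turns the first point of the chain into an i.i.d. one. The total [a + n] stays fixed,
    so all [n] steps have the same cost. *)
Lemma statE_iidE_bound a n phi : seq_symmetric phi ->
  (forall s, `|phi s| <= 1) ->
  `|iidE pi a (fun s0 => statE pi b n (fun s => phi (s0 ++ s))) -
    iidE pi (a + n) phi| <= n%:R * (288 * eps / (a + n)%:R).
Proof.
move=> phiS phi1; elim: n a => [|n IHn] a.
  rewrite mul0r addn0 (_ : (fun s0 => _) = phi) ?subrr ?normr0//.
  by apply/funext => s0 /=; rewrite cats0.
under eq_fun => s0 do rewrite statE_expansion.
rewrite linear_functionalD; last exact: iidE_linear.
have -> : iidE pi a (fun s0 => \sum_x pi x *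
    statE pi b n (fun s => phi (s0 ++ x :: s))) =
  iidE pi a.+1 (fun s0 => statE pi b n (fun s => phi (s0 ++ s))).
  rewrite iidE_linear iidES; apply: eq_bigr => x _; congr (_ * _).
  congr iidE; apply/funext => s0; congr statE; apply/funext => s.
  by apply: phiS; rewrite -(cat1s x) (perm_catCA _ [:: x]).
rewrite addrAC -addSnnS (le_trans (ler_normD _ _))// -(natr1 n) mulrDl mul1r.
rewrite lerD ?IHn//.
rewrite [in X in `|X|]iidE_linear.
rewrite (le_trans (ler_norm_sum _ _ _))//.
apply: (le_trans _ (@sum_run_bound n (a.+1 + n)%N _)); last by lia.
apply: ler_sum => l _.
have el : 0 <= eps ^+ l.+1 by rewrite exprn_ge0// ltW.
rewrite normrM ger0_norm// ler_wpM2l//.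
apply: (le_trans (statE_run_bound _ _ _ phiS phi1)).
rewrite (_ : (a + (n - l.+1) + 1)%N = (a.+1 + n - l.+1)%N)//.
by have := ltn_ord l; lia.
Qed.

Lemma markovE_iidE_bound g n phi : seq_symmetric phi ->
  (forall s, `|phi s| <= 1) -> (forall x, `|g x - 1| <= eps) ->
  `|\sum_x pi x * g x * markovE pi b n x (fun s => phi (x :: s)) -
    iidE pi n.+1 phi| <= 289 * eps.
Proof.
move=> phiS phi1 g1.
have := statE_iidE_bound 0 n.+1 phiS phi1.
rewrite add0n mulrC divfK ?pnatr_eq0// [in X in X -> _]/= -iidES => B.
rewrite -(subrK (\sum_x pi x * markovE pi b n x (fun s => phi (x :: s)))
  (\sum_x pi x * g x * _)) -addrA (le_trans (ler_normD _ _))//.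
(* The extra [eps] pays for replacing the initial density [g] by 1. *)
rewrite (_ : 289 * eps = eps + 288 * eps); last by ring.
rewrite lerD// -sumrB; under eq_bigr do rewrite -mulrA -mulrBr.
apply: (pi_average_le pi_ge0 pi_sum1) => x.
rewrite -[X in _ - X]mul1r -mulrBl normrM -[leRHS]mulr1 ler_pM//.
exact: markovE_bound_b.
Qed.

End perturbed_iid.

(** * Finite partitions and discrete paths *)

Section finite_fibers.
Context {d : measure_display} {W : measurableType d} {T : finType}.

(** The finite type carries no sigma-algebra, so measurability is required on each fibre. *)
Definition finite_measurable (f : W -> T) :=
  forall t, measurable (f @^-1` [set t]).

Lemma measure_fibers {R : realType} (mu : {measure set W -> \bar R}) f A :
  finite_measurable f -> measurable A ->
  mu A = (\sum_t mu (A `&` f @^-1` [set t]))%E.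
Proof.
move=> mf mA; rewrite fsbig_seq ?index_enum_uniq// -measure_fin_bigcup//=.
- rewrite -setI_bigcupr; congr (mu _); rewrite setIidl// => w _.
  by exists (f w) => //=; rewrite mem_index_enum.
- by move=> s t _ _ [w [[_ /= <-] [_ /= <-]]].
- by move=> t _; apply: measurableI => //; exact: mf.
Qed.

Lemma fine_fibers {R : realType} (P : probability W R) f A :
  finite_measurable f -> measurable A ->
  fine (P A) = \sum_t fine (P (A `&` f @^-1` [set t])).
Proof.
move=> mf mA; rewrite (measure_fibers P mf mA) sum_fine// => t _.
by apply: fin_num_measure; apply: measurableI => //; exact: mf.
Qed.

Lemma fine_fibers_sum1 {R : realType} (P : probability W R) f :
  finite_measurable f -> \sum_t fine (P (f @^-1` [set t])) = 1.
Proof.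
move=> mf; have := fine_fibers P mf measurableT.
by rewrite probability_setT /=; under eq_bigr do rewrite setTI.
Qed.

End finite_fibers.

Lemma finite_measurable_pair d (W : measurableType d) (T T' : finType)
  (f : W -> T) (f' : W -> T') : finite_measurable f -> finite_measurable f' ->
  finite_measurable (fun w => (f w, f' w)).
Proof.
move=> mf mf' [t t'].
rewrite (_ : _ @^-1` _ = f @^-1` [set t] `&` f' @^-1` [set t']).
  by apply: measurableI; [exact: mf|exact: mf'].
by apply/seteqP; split => w /= [-> ->].
Qed.

Lemma finite_measurable_ffun d (W : measurableType d) (I : finType)
  (b : I -> W -> bool) : (forall i, measurable [set w | b i w]) ->
  finite_measurable (fun w => [ffun i => b i w]).
Proof.
move=> mb t; rewrite (_ : _ @^-1` _ =
    \bigcap_(i in [set: I])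
      (if t i then [set w | b i w] else ~` [set w | b i w])).
  apply: fin_bigcap_measurable => // i _; case: ifP => // _.
  exact: measurableC.
apply/seteqP; split => w /=.
  by move=> <- i _; rewrite ffunE; case: ifPn => //= /negP.
move=> h; apply/ffunP => i; rewrite ffunE.
by have := h i Logic.I; case: ifPn => //= _ /negP/negbTE.
Qed.

Section discrete_paths.
Context {R : realType} {d : measure_display} {W : measurableType d}.
Context (P : probability W R) {T : finType} (C : nat -> W -> T).
Hypothesis mC : forall i, finite_measurable (C i).

Definition path_of n w : seq T := mkseq (C^~ w) n.

Definition cylinder (s : seq T) : set W := [set w | path_of (size s) w = s].

Lemma path_ofS n w : path_of n.+1 w = rcons (path_of n w) (C n w).
Proof. by rewrite /path_of mkseqS. Qed.

Lemma cylinder_rcons s x :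
  cylinder (rcons s x) = cylinder s `&` C (size s) @^-1` [set x].
Proof.
apply/seteqP; split => w; rewrite /cylinder/= size_rcons path_ofS.
  by move=> /eqP; rewrite eqseq_rcons => /andP[/eqP ? /eqP ?].
by move=> [-> ->].
Qed.

Lemma cylinder1 x : cylinder [:: x] = C 0%N @^-1` [set x].
Proof.
apply/seteqP; split => w; rewrite /cylinder/path_of/=; first by case.
by move=> wx; rewrite -wx.
Qed.

Lemma measurable_cylinder s : measurable (cylinder s).
Proof.
elim/last_ind: s => [|s x ms].
  by rewrite (_ : cylinder _ = setT)//; apply/seteqP; split.
by rewrite cylinder_rcons; apply: measurableI => //; exact: mC.
Qed.

Lemma measurable_path_of n (D : set (seq T)) :
  measurable [set w | D (path_of n w)].
Proof.
elim: n D => [|n IHn] D.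
  have [D0|D0] := pselect (D [::]).
    by rewrite (_ : [set _ | _] = setT)//; apply/seteqP; split.
  by rewrite (_ : [set _ | _] = set0)//; apply/seteqP; split.
rewrite (_ : [set _ | _] = \bigcup_(t in [set: T])
  ([set w | D (rcons (path_of n w) t)] `&` C n @^-1` [set t])).
  apply: fin_bigcup_measurable => // t _; apply: measurableI; last exact: mC.
  exact: (IHn [set s | D (rcons s t)]).
apply/seteqP; split => [w Dw|w [t _ [Dw /= tE]]] /=.
  by exists (C n w) => //; split => //=; rewrite -path_ofS.
by rewrite path_ofS tE.
Qed.

Variables (pi : T -> R) (b : T -> T -> R) (delta : R).
Hypothesis pi_ge0 : forall x, 0 <= pi x.
Hypothesis pi_sum1 : \sum_x pi x = 1.
Hypothesis b_ge0 : forall x y, 0 <= b x y.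
Hypothesis b_row : forall x, \sum_y pi y * b x y = 1.
Hypothesis approx_markov : forall s x y,
  `|fine (P (cylinder (rcons (rcons s x) y))) -
    fine (P (cylinder (rcons s x))) * (pi y * b x y)| <=
  fine (P (cylinder (rcons s x))) * (pi y * delta).

(** A joint rather than a conditional probability, which avoids dividing by null cylinders. *)
Let cylinder_cond r s (D : pred (seq T)) : R :=
  fine (P (cylinder s `&` [set w | D (path_of (size s + r) w)])).

Let cylinder_condS r s D :
  cylinder_cond r.+1 s D = \sum_y cylinder_cond r (rcons s y) D.
Proof.
rewrite /cylinder_cond (fine_fibers P (mC (size s))); last first.
  apply: measurableI; first exact: measurable_cylinder.
  exact: (measurable_path_of _ [set t | D t]).
by apply: eq_bigr => y _; rewrite cylinder_rcons size_rcons addSnnS setIAC.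
Qed.

(** Transitions are replaced one at a time by [pi y * b x y]. Each replacement costs [delta]
    relative to the mass of the cylinder, and the masses of its extensions add up to that mass, so
    the errors grow only linearly in [r]. *)
Let cylinder_cond_markovE r s x D :
  `|cylinder_cond r (rcons s x) D - fine (P (cylinder (rcons s x))) *
      markovE pi b r x (fun t => (D (rcons s x ++ t))%:R)| <=
  fine (P (cylinder (rcons s x))) * (r%:R * delta).
Proof.
elim: r s x => [|r IHr] s x.
  rewrite mul0r mulr0 /= cats0 /cylinder_cond addn0.
  set S := cylinder _.
  rewrite (_ : S `&` _ = if D (rcons s x) then S else set0).
    by case: ifP; rewrite ?measure0 ?mulr0 ?mulr1 subrr normr0.
  apply/seteqP; split => w /=.
    by move=> [Sw]; rewrite [path_of _ _]Sw => ->.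
  by case: ifP => // DS Sw; split => //; rewrite [path_of _ _]Sw.
set p := fine (P _).
have p0 : 0 <= p by exact: fine_ge0.
pose M y := markovE pi b r y (fun t => (D (rcons (rcons s x) y ++ t))%:R).
have M1 y : `|M y| <= 1.
  apply: (markovE_bound pi_ge0) => [z|t]; last first.
    by case: (D _); rewrite ?normr1 ?normr0.
  by rewrite -(b_row z) ler_sum// => ? _; rewrite ger0_norm.
rewrite cylinder_condS.
have -> : markovE pi b r.+1 x (fun t => (D (rcons s x ++ t))%:R) =
    \sum_y pi y * b x y * M y.
  apply: eq_bigr => y _; congr (_ * markovE _ _ _ _ _); apply/funext => t.
  by rewrite (cat_rcons y).
have pE : p = \sum_y fine (P (cylinder (rcons (rcons s x) y))).
  rewrite {1}/p (fine_fibers P (mC (size (rcons s x)))); last first.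
    exact: measurable_cylinder.
  by apply: eq_bigr => y _; rewrite [in RHS]cylinder_rcons.
rewrite mulr_sumr -sumrB.
pose q y := fine (P (cylinder (rcons (rcons s x) y))).
have -> : \sum_y (cylinder_cond r (rcons (rcons s x) y) D -
      p * (pi y * b x y * M y)) =
    \sum_y ((cylinder_cond r (rcons (rcons s x) y) D - q y * M y) +
      (q y - p * (pi y * b x y)) * M y).
  by apply: eq_bigr => y _; ring.
rewrite big_split/= (le_trans (ler_normD _ _))//.
rewrite -(natr1 r) mulrDl mul1r mulrDr; apply: lerD.
  by rewrite {1}pE mulr_suml (le_trans (ler_norm_sum _ _ _))// ler_sum.
rewrite (le_trans (ler_norm_sum _ _ _))//.
rewrite -[X in _ <= p * X]mul1r -pi_sum1 mulr_suml mulr_sumr ler_sum// => y _.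
by rewrite normrM -[leRHS]mulr1; apply: ler_pM => //; exact: approx_markov.
Qed.

Lemma path_of_approx n (D : pred (seq T)) : 0 <= delta ->
  `|fine (P [set w | D (path_of n.+1 w)]) -
    \sum_x fine (P (C 0%N @^-1` [set x])) *
      markovE pi b n x (fun t => (D (x :: t))%:R)| <= n%:R * delta.
Proof.
move=> delta0.
have -> : [set w | D (path_of n.+1 w)] =
    cylinder [::] `&` [set w | D (path_of (size ([::] : seq T) + n.+1)%N w)].
  by apply/seteqP; split => w //= [].
rewrite -[X in `|X - _|]/(cylinder_cond n.+1 [::] D) cylinder_condS -sumrB.
rewrite (le_trans (ler_norm_sum _ _ _))//.
apply: (@le_trans _ _ (\sum_x fine (P (C 0%N @^-1` [set x])) * (n%:R * delta))).
  apply: ler_sum => x _; rewrite -cylinder1.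
  exact: (cylinder_cond_markovE n [::] x D).
by rewrite -mulr_suml (fine_fibers_sum1 P (mC 0%N)) mul1r.
Qed.

End discrete_paths.

(** * Partitioning the state space *)

Section bounded_densities.
Context {R : realType} {d : measure_display} {S : measurableType d}.
Variable Q : probability S R.

(** Finiteness is proved along with the estimate because [fine] sends infinite values to 0. *)
Lemma fine_integral_near (f : S -> R) (A : set S) (a eta : R) :
  measurable A -> measurable_fun A f ->
  (forall u, A u -> `|f u - a| <= eta) ->
  (\int[Q]_(u in A) (f u)%:E)%E \is a fin_num /\
  `|fine (\int[Q]_(u in A) (f u)%:E)%E - a * fine (Q A)| <= eta * fine (Q A).
Proof.
move=> mA mf fa.
have QA : Q A \is a fin_num by exact: fin_num_measure.
have intf : Q.-integrable A (EFin \o f).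
  apply: measurable_bounded_integrable => //.
    by rewrite ltey_eq QA.
  exists (`|a| + eta); split; first exact: num_real.
  move=> M aM u Au /=; rewrite ltW// (le_lt_trans _ aM)//.
  rewrite -(subrK a (f u)) (le_trans (ler_normD _ _))// addrC lerD//.
  exact: fa.
have fin : (\int[Q]_(u in A) (f u)%:E)%E \is a fin_num.
  exact: integrable_fin_num intf.
split=> //.
have intc c : Q.-integrable A (EFin \o cst c).
  by apply: finite_measure_integrable_cst.
have cstE c : (\int[Q]_(u in A) (cst c u)%:E = (c * fine (Q A))%:E)%E.
  by rewrite (integral_cst Q mA c%:E) EFinM fineK.
have lo : (((a - eta) * fine (Q A))%:E <= \int[Q]_(u in A) (f u)%:E)%E.
  rewrite -cstE; apply: (le_integral mA); [exact: intc|exact: intf|move=> u].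
  by rewrite inE => /fa; rewrite lee_fin ler_norml => /andP[+ _];
    rewrite /cst; lra.
have hi : (\int[Q]_(u in A) (f u)%:E <= ((a + eta) * fine (Q A))%:E)%E.
  rewrite -cstE; apply: (le_integral mA); [exact: intf|exact: intc|move=> u].
  by rewrite inE => /fa; rewrite lee_fin ler_norml => /andP[_ +];
    rewrite /cst; lra.
move: lo hi; rewrite -[X in (_ <= X)%E -> (X <= _)%E -> _](fineK fin) !lee_fin.
rewrite ler_norml !mulrDl mulNr => lo hi; apply/andP; split; lra.
Qed.

End bounded_densities.

Section metric_partition.
Context {R : realType} {d : measure_display} {S : measurableMetricType d R}.
Hypothesis borel : @measurable d S = <<s @open S >>.

Lemma measurable_ball (x : S) (r : R) : measurable (ball x r).
Proof.
have -> : ball x r = (ball x r)° .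
  apply/seteqP; split => [y|]; last exact: interior_subset.
  rewrite -metricType_numDomainType.ball_mdistE/= => xy.
  rewrite /interior -nbhs_ballE; exists (r - mdist x y) => /=.
    by rewrite subr_gt0.
  move=> z; rewrite -metricType_numDomainType.ball_mdistE/= => yz.
  by rewrite (le_lt_trans (metric_triangle x y z))// -ltrBrDl.
by rewrite borel; apply: sub_sigma_algebra; exact: open_interior.
Qed.

(** The cells are the atoms generated by a finite cover: two points of one cell lie in a common
    ball. *)
Lemma covering_partition (r : R) (M : R) : (covering_number S r <= M%:E)%E ->
  exists (T : finType) (c : S -> T), finite_measurable c /\
    forall u v, c u = c v -> mdist u v < 2 * r.
Proof.
rewrite /covering_number; set E := (X in ereal_inf X) => EM.
(* Without a finite cover the infimum would be infinite, against the bound by a real number. *)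
have [E0|/set0P[_ [N [c [rho [rhor cov]]] _]]] := eqVneq E set0.
  by move: EM; rewrite E0 ereal_inf0.
exists {ffun 'I_N -> bool}, (fun u => [ffun i => `[< ball (c i) (rho i) u >]]).
split.
  apply: finite_measurable_ffun => i.
  rewrite (_ : [set _ | _] = ball (c i) (rho i)); first exact: measurable_ball.
  by apply/seteqP; split => u /asboolP.
move=> u v uv; have [i _ iu] := cov u Logic.I.
have iv : ball (c i) (rho i) v.
  have := congr1 (fun h : {ffun 'I_N -> bool} => h i) uv.
  by rewrite !ffunE => e; apply/asboolP; rewrite -e; exact/asboolP.
move: iu iv; rewrite -metricType_numDomainType.ball_mdistE/= => iu iv.
have /andP[_ ir] := rhor i.
rewrite (le_lt_trans (metric_triangle _ (c i) _))// metric_sym.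
by rewrite (lt_le_trans (ltrD iu iv))//; lra.
Qed.

End metric_partition.

(** The highest level below the larger number is also below the smaller one, and the next level
    exceeds both. The case [s = 0] is kept since it arises from null cells. *)
Lemma same_levels_close (R : realType) (s u v : R) (M : nat) : 0 <= s ->
  0 <= u -> 0 <= v -> u <= M%:R * s -> v <= M%:R * s ->
  (forall j : 'I_M.+1, (j%:R * s <= u) = (j%:R * s <= v)) -> `|u - v| <= s.
Proof.
wlog uv : u v / u <= v => [hw|].
  move=> s0 u0 v0 uM vM jj; have [uv|/ltW vu] := leP u v; first exact: hw.
  by rewrite distrC; apply: hw.
rewrite le_eqVlt => /orP[/eqP <-|s0] u0 v0 uM vM jj.
  by move: uM vM; rewrite mulr0 => ? ?; rewrite ler_norml; lra.
have vs0 : 0 <= v / s by rewrite divr_ge0// ltW.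
have /andP[t1 t2] := truncn_itv vs0.
have tM : (Num.truncn (v / s) < M.+1)%N.
  by rewrite ltnS -(ler_nat R) (le_trans t1)// ler_pdivrMr.
have := jj (Ordinal tM); rewrite -[in RHS]ler_pdivlMr// t1 => /= tu.
move: t2; rewrite ltr_pdivrMr// -natr1 mulrDl mul1r => t2.
by rewrite ler_norml; apply/andP; split; move: (_ * s) tu t2 => z ? ?; lra.
Qed.

(** * Reduction of the transition kernel to finitely many cells *)

Section kernel_partition.
Context {R : realType} {d : measure_display} {S : measurableType d}.
Variables (Pi : probability S R) (k : R.-pker S ~> S) (p : S -> S -> R).
Variable eps : R.
Hypothesis k_density : forall x, has_density (k x) Pi (p x).
Hypothesis p_near1 : forall x y, `|p x y - 1| <= eps.

Lemma kernel_near x A a eta : measurable A ->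
  (forall u, A u -> `|p x u - a| <= eta) ->
  k x A \is a fin_num /\
  `|fine (k x A) - a * fine (Pi A)| <= eta * fine (Pi A).
Proof.
move=> mA pa; have [mp kA] := k_density x; rewrite kA//.
by apply: fine_integral_near => //; exact: measurable_funTS.
Qed.

Lemma kernel_fin x A : measurable A -> k x A \is a fin_num.
Proof. by move=> mA; have [] := @kernel_near x A 1 eps mA. Qed.

Lemma kernel_near1 x A : measurable A ->
  `|fine (k x A) - fine (Pi A)| <= eps * fine (Pi A).
Proof.
move=> mA; have [_] := @kernel_near x A 1 eps mA (fun u _ => p_near1 x u).
by rewrite mul1r.
Qed.

Lemma measurable_kernel_fine A : measurable A ->
  measurable_fun setT (fun x => fine (k x A)).
Proof.
move=> mA; apply/measurable_EFinP.
rewrite (_ : EFin \o _ = k ^~ A); first exact: measurable_kernel.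
by apply/funext => x /=; rewrite fineK// kernel_fin.
Qed.

Lemma kernel_fibers {T : finType} (c : S -> T) x : finite_measurable c ->
  \sum_y fine (k x (c @^-1` [set y])) = 1.
Proof.
move=> mc; have := measure_fibers (k x) mc measurableT.
rewrite prob_kernel; under eq_bigr do rewrite setTI.
rewrite sum_fine => [<-//|y _]; exact: kernel_fin.
Qed.

(** The error is relative to the mass of the target cell, so that its sum over all targets is
    [delta]. *)
Definition kernel_steady (delta : R) {T : finType} (c : S -> T) :=
  forall y z z', c z = c z' ->
    `|fine (k z (c @^-1` [set y])) - fine (k z' (c @^-1` [set y]))| <=
    delta * fine (Pi (c @^-1` [set y])).

Hypothesis eps_le1 : eps <= 1.
Hypothesis p_partition : forall delta : R, 0 < delta ->
  exists (T : finType) (c : S -> T), finite_measurable c /\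
    forall u v, c u = c v -> forall x, `|p x u - p x v| <= delta.

(* First cut [S] into cells on which the densities [p x] oscillate little, then
   cut further along the levels of the transition probabilities into those
   cells: within the final cells, both arguments of [p] hardly matter. *)
Lemma kernel_steady_refinement (T0 : finType) (c0 : S -> T0) (delta : R) :
  0 < delta -> finite_measurable c0 ->
  exists (T : finType) (c : S -> T) (g : T -> T0),
    [/\ finite_measurable c, (forall z, c0 z = g (c z)) &
        kernel_steady delta c].
Proof.
move=> delta0 mc0.
(* The factor 5 is 3 for the difference of two densities at a reference point and 1 for each of the
   two transition probabilities. *)
have [e e0 ->] : exists2 e, 0 < e & delta = 5 * e.
  by exists (delta / 5); [rewrite divr_gt0|field].
have [T1 [c1 [mc1 c1p]]] := p_partition e0.
pose q i := fine (Pi (c1 @^-1` [set i])).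
have q0 i : 0 <= q i by exact: fine_ge0.
pose K i z := fine (k z (c1 @^-1` [set i])).
have K0 i z : 0 <= K i z by exact: fine_ge0.
(* Enough levels of spacing [e * q i] to reach [2 * q i], which bounds every [K i z] because [eps]
   is at most 1. *)
pose M := (Num.truncn (2 / e)).+1.
have M2 : 2 <= M%:R * e.
  have /truncn_itv/andP[_ /ltW] : 0 <= 2 / e by rewrite divr_ge0// ltW.
  by rewrite ler_pdivrMr.
have KM i z : K i z <= M%:R * (e * q i).
  have := kernel_near1 z (mc1 i).
  rewrite -/(K i z) -/(q i) ler_norml => /andP[_].
  have : 2 * q i <= M%:R * e * q i by rewrite ler_wpM2r.
  have : eps * q i <= 1 * q i by rewrite ler_wpM2r.
  by rewrite mulrA; move: (M%:R * e * q i) (eps * q i) => ? ?; lra.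
pose lev z := [ffun ij : T1 * 'I_M.+1 => ij.2%:R * (e * q ij.1) <= K ij.1 z].
pose c z := (c0 z, c1 z, lev z).
have mc : finite_measurable c.
  apply: finite_measurable_pair; first exact: finite_measurable_pair.
  apply: finite_measurable_ffun => -[i j] /=.
  have := measurable_kernel_fine (mc1 i) measurableT
    (measurable_itv `[j%:R * (e * q i), +oo[).
  rewrite setTI; congr measurable.
  by apply/seteqP; split => u /=; rewrite in_itv/= andbT.
exists _, c, (fun t => t.1.1); split=> // y z z' [_ _ /ffunP zz'].
set C := c @^-1` [set y]; pose i := y.1.2.
have [C0|/set0P[u0 Cu0]] := eqVneq C set0.
  by rewrite C0 !measure0 subrr normr0 mulr0.
have mC : measurable C by exact: mc.
have u0i : c1 u0 = i by rewrite /i -Cu0.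
have N w : `|K i w - p w u0 * q i| <= e * q i.
  apply: (kernel_near (mc1 i) _).2 => u /= ui.
  by apply: c1p; rewrite ui.
have N' w : `|fine (k w C) - p w u0 * fine (Pi C)| <= e * fine (Pi C).
  apply: (kernel_near mC _).2 => u Cu.
  by apply: c1p; rewrite u0i /i -Cu.
have Cq : fine (Pi C) <= q i.
  have mq : measurable (c1 @^-1` [set i]) by exact: mc1.
  apply: fine_le; [exact: fin_num_measure..|].
  by apply: le_measure; rewrite ?inE// => u Cu /=; rewrite /i -Cu.
have L : `|K i z - K i z'| <= e * q i.
  apply: (@same_levels_close _ _ _ _ M) => // [|j].
    by rewrite mulr_ge0// ltW.
  by have := zz' (i, j); rewrite !ffunE.
have [C0|C0] := eqVneq (fine (Pi C)) 0.
  have := N' z; have := N' z'; rewrite C0 !mulr0 !subr0 !normr_le0.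
  by move=> /eqP-> /eqP->; rewrite subrr.
have {}C0 : 0 < fine (Pi C) by rewrite lt_def C0 fine_ge0.
have qi0 : 0 < q i by exact: lt_le_trans Cq.
(* The transition probabilities into the coarse cell determine the densities at [u0] up to [e]; this
   carries closeness over to the finer target cell. *)
have D : `|p z u0 - p z' u0| <= 3 * e.
  rewrite -(ler_pM2r qi0) -[X in _ * X <= _](gtr0_norm qi0) -normrM mulrBl.
  have := N z; have := N z'; move: L; rewrite !ler_norml -(mulrA 3).
  move: (e * q i) (p z u0 * q i) (p z' u0 * q i) => ? ? ?.
  by move=> /andP[? ?] /andP[? ?] /andP[? ?]; apply/andP; split; lra.
have : `|(p z u0 - p z' u0) * fine (Pi C)| <= 3 * e * fine (Pi C).
  by rewrite normrM (gtr0_norm C0) ler_pM2r.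
have := N' z; have := N' z'; rewrite !ler_norml mulrBl -!mulrA.
move: (e * _) (p z u0 * _) (p z' u0 * _) => ? ? ?.
by move=> /andP[? ?] /andP[? ?] /andP[? ?]; apply/andP; split; lra.
Qed.

Hypothesis k_invariant : Defs.invariant k Pi.

Section averaged_kernel.
Context {T : finType} (c : S -> T) (delta : R).
Hypothesis mc : finite_measurable c.
Hypothesis c_steady : kernel_steady delta c.
Hypothesis eps_ge0 : 0 <= eps.

Let pi x : R := fine (Pi (c @^-1` [set x])).
(** The law of two consecutive cells of the stationary chain. Both marginals are [pi], the second
    one by invariance; this makes the averaged kernel centred exactly in both arguments. *)
Let J x y : R := fine (\int[Pi]_(z in c @^-1` [set x]) k z (c @^-1` [set y]))%E.

Let pi_ge0 x : 0 <= pi x. Proof. exact: fine_ge0. Qed.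

Let JP x y a eta :
  (forall z, c z = x -> `|fine (k z (c @^-1` [set y])) - a| <= eta) ->
  (\int[Pi]_(z in c @^-1` [set x]) k z (c @^-1` [set y]))%E \is a fin_num /\
  `|J x y - a * pi x| <= eta * pi x.
Proof.
move=> ka; rewrite /J.
under eq_integral do rewrite -(fineK (kernel_fin _ (mc y))).
apply: fine_integral_near => //.
by apply: measurable_funTS; exact: measurable_kernel_fine.
Qed.

Let J_near1 x y : `|J x y - pi y * pi x| <= eps * pi y * pi x.
Proof. by apply: (JP _).2 => z _; exact: kernel_near1. Qed.

Let J_fin x y :
  (\int[Pi]_(z in c @^-1` [set x]) k z (c @^-1` [set y]))%E \is a fin_num.
Proof. exact: (JP (fun z _ => kernel_near1 z (mc y))).1. Qed.

Let J0l x y : pi x = 0 -> J x y = 0.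
Proof.
by move=> x0; have := J_near1 x y; rewrite x0 !mulr0 subr0 normr_le0 => /eqP.
Qed.

Let J0r x y : pi y = 0 -> J x y = 0.
Proof.
move=> y0; have := J_near1 x y.
by rewrite y0 !mulr0 !mul0r subr0 normr_le0 => /eqP.
Qed.

Let K0 z y : pi y = 0 -> fine (k z (c @^-1` [set y])) = 0.
Proof.
move=> y0; have := kernel_near1 z (mc y).
by rewrite -/(pi y) y0 mulr0 subr0 normr_le0 => /eqP.
Qed.

Let J_row x : \sum_y J x y = pi x.
Proof.
rewrite sum_fine => [|y _]; last exact: J_fin.
rewrite -ge0_integral_sum//; last first.
  by move=> y; apply: measurable_funTS; exact: measurable_kernel.
congr fine; under eq_integral => z _.
  rewrite (_ : (\sum_y k z _)%E = 1%E); first over.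
  rewrite -(prob_kernel (s := k) z) (measure_fibers (k z) mc measurableT).
  by under [RHS]eq_bigr do rewrite setTI.
by rewrite integral_cst//= mul1e.
Qed.

Let J_col y : \sum_x J x y = pi y.
Proof.
rewrite sum_fine => [|x _]; last exact: J_fin.
rewrite -ge0_integral_bigsetU ?index_enum_uniq//; first last.
- by apply: measurable_funTS; exact: measurable_kernel.
- by move=> s t _ _ [w [/= <- <-]].
congr fine; rewrite -k_invariant//; congr integral.
apply/seteqP; split => // z _; rewrite -bigcup_seq; exists (c z) => //=.
by rewrite mem_index_enum.
Qed.

Let pi_sum1 : \sum_x pi x = 1.
Proof. exact: fine_fibers_sum1. Qed.

(* On cells of measure zero the entries do not enter the column sums, and are
   read off an arbitrary point of the cell. *)
Definition averaged_kernel (x y : T) : R :=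
  if pi y == 0 then 1 else
  if pi x != 0 then J x y / (pi x * pi y) else
  if pselect (exists z, c z = x) is left h
  then fine (k (projT1 (cid h)) (c @^-1` [set y])) / pi y else 1.

Lemma averaged_kernel_row x : \sum_y pi y * averaged_kernel x y = 1.
Proof.
rewrite /averaged_kernel; have [x0|x0] /= := eqVneq (pi x) 0.
  case: pselect => [h|_].
    rewrite -(kernel_fibers (projT1 (cid h)) mc); apply: eq_bigr => y _.
    have [y0|y0] := eqVneq (pi y) 0; first by rewrite y0 mul0r K0.
    by rewrite mulrCA mulfV// mulr1.
  by rewrite -[RHS]pi_sum1; apply: eq_bigr => y _; rewrite if_same mulr1.
rewrite -(mulfV x0) -[X in _ = X / _]J_row mulr_suml; apply: eq_bigr => y _.
have [y0|y0] := eqVneq (pi y) 0; first by rewrite J0r// y0 !mul0r.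
by field; apply/andP; split.
Qed.

Lemma averaged_kernel_col y : \sum_x pi x * averaged_kernel x y = 1.
Proof.
rewrite /averaged_kernel; have [y0|y0] /= := eqVneq (pi y) 0.
  by under eq_bigr do rewrite mulr1.
rewrite -(mulfV y0) -[X in _ = X / _]J_col mulr_suml; apply: eq_bigr => x _.
have [x0|x0] /= := eqVneq (pi x) 0; first by rewrite J0l// x0 !mul0r.
by field; apply/andP; split.
Qed.

Lemma averaged_kernel_near1 x y : `|averaged_kernel x y - 1| <= eps.
Proof.
rewrite /averaged_kernel; case: ifPn => [_|y0]; first by rewrite subrr normr0.
have {}y0 : 0 < pi y by rewrite lt_def y0 pi_ge0.
case: ifPn => [x0|_].
  have {}x0 : 0 < pi x by rewrite lt_def x0 pi_ge0.
  have xy0 : 0 < pi x * pi y by rewrite mulr_gt0.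
  rewrite -(ler_pM2r xy0) -[X in _ * X <= _](gtr0_norm xy0) -normrM.
  rewrite mulrBl mul1r.
  rewrite divfK ?gt_eqF//; have := J_near1 x y.
  by rewrite [pi y * pi x]mulrC -mulrA [pi y * pi x]mulrC.
case: pselect => [h|_]; last by rewrite subrr normr0.
rewrite -(ler_pM2r y0) -[X in _ * X <= _](gtr0_norm y0) -normrM mulrBl mul1r.
by rewrite divfK ?gt_eqF//; exact: kernel_near1.
Qed.

(** An average over the source cell differs from the value at [z] by at most the oscillation over
    that cell. *)
Lemma averaged_kernel_approx z y :
  `|fine (k z (c @^-1` [set y])) - pi y * averaged_kernel (c z) y| <=
  pi y * delta.
Proof.
rewrite /averaged_kernel; case: ifPn => [/eqP y0|y0].
  by rewrite K0// y0 !mul0r subrr normr0.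
case: ifPn => [x0|_].
  have {}x0 : 0 < pi (c z) by rewrite lt_def x0 pi_ge0.
  have JK : `|J (c z) y - fine (k z (c @^-1` [set y])) * pi (c z)| <=
      delta * pi y * pi (c z).
    by apply: (JP _).2 => z' zz'; exact: c_steady.
  rewrite -(ler_pM2r x0) -[X in _ * X <= _](gtr0_norm x0) -normrM mulrBl distrC.
  rewrite (_ : _ * _ * pi (c z) = J (c z) y); first by rewrite [pi y * _]mulrC.
  by field; rewrite y0 gt_eqF.
case: pselect => [h|[]]; last by exists z.
rewrite mulrCA mulfV// mulr1 [leRHS]mulrC; apply: c_steady.
by case: cid.
Qed.

End averaged_kernel.

End kernel_partition.

(** * Laws of the discretised paths *)

Section iid_paths.
Context {R : realType} {d dW : measure_display} {S : measurableType d}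
  {W : measurableType dW}.
Variables (P : probability W R) (Pi : probability S R).
Variable Y : nat -> {RV P >-> S}.
Hypothesis Y_iid : iid P Pi Y.
Context {T : finType} (c : S -> T).
Hypothesis mc : finite_measurable c.

Let pi x : R := fine (Pi (c @^-1` [set x])).
Let C i w := c (Y i w).

Lemma finite_measurable_RV (Z : {RV P >-> S}) :
  finite_measurable (fun w => c (Z w)).
Proof.
by move=> t; rewrite -[_ @^-1` _]/(Z @^-1` (c @^-1` [set t]));
  apply: measurable_funPTI; exact: mc.
Qed.

Lemma iid_cylinder s : fine (P (cylinder C s)) = \prod_(x <- s) pi x.
Proof.
case: s => [|x0 s'].
  rewrite big_nil (_ : cylinder _ _ = setT) ?probability_setT//.
  by apply/seteqP; split.
move: (x0 :: s') => s; pose J : {fset nat} := [fset i in iota 0 (size s)]%fset.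
pose A i := c @^-1` [set nth x0 s i].
have [ind idt] := Y_iid.
have JE i : (i \in J) = (i < size s)%N by rewrite inE mem_iota add0n.
have := ind J A (fun i _ => mc (nth x0 s i)).
have -> : \bigcap_(i in [set` J]) Y i @^-1` A i = cylinder C s.
  apply/seteqP; split => w; rewrite /cylinder /=.
    move=> h; apply: (@eq_from_nth _ x0); rewrite size_mkseq// => i si.
    by rewrite nth_mkseq//; apply: h; rewrite /= JE.
  by move=> h i /=; rewrite JE => si; rewrite /A /= -h nth_mkseq.
move=> ->.
have -> : (\prod_(i <- J) P (Y i @^-1` A i) =
    \prod_(i <- J) (pi (nth x0 s i))%:E)%E.
  apply: eq_bigr => i _; rewrite /pi fineK; last first.
    by apply: fin_num_measure; exact: mc.
  by rewrite -(idt i)//; exact: mc.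
rewrite prodEFin /= (big_nth x0) /index_iota subn0.
by apply: perm_big; apply: uniq_perm; rewrite ?fset_uniq ?iota_uniq// => i;
  rewrite JE mem_iota add0n.
Qed.

(** The approximation for Markov paths with density 1 and [delta = 0], where it becomes an
    equality. *)
Lemma iid_path_law n (D : pred (seq T)) :
  fine (P [set w | D (path_of C n.+1 w)]) = iidE pi n.+1 (fun s => (D s)%:R).
Proof.
have pi_sum1 : \sum_x pi x = 1 by exact: fine_fibers_sum1.
have mC i : finite_measurable (C i) by exact: finite_measurable_RV.
have h : forall s x y, `|fine (P (cylinder C (rcons (rcons s x) y))) -
    fine (P (cylinder C (rcons s x))) * (pi y * 1)| <=
    fine (P (cylinder C (rcons s x))) * (pi y * 0).
  move=> s x y.
  by rewrite !iid_cylinder big_rcons/= mulr1 mulrC subrr normr0 !mulr0.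
have row1 (x : T) : \sum_y pi y * 1 = 1 by under eq_bigr do rewrite mulr1.
have := @path_of_approx _ _ _ P T C mC pi (fun _ _ => 1) 0
  (fun x => fine_ge0 (measure_ge0 _ _)) pi_sum1 (fun _ _ => ler01) row1 h n D
  (lexx 0).
rewrite mulr0 normr_le0 subr_eq0 => /eqP ->.
rewrite iidES; apply: eq_bigr => x _; rewrite (iidE_markovE pi n x).
congr (_ * _); have := iid_cylinder [:: x].
by rewrite big_seq1 cylinder1.
Qed.

End iid_paths.

Section markov_paths.
Context {R : realType} {d dW : measure_display} {S : measurableType d}
  {W : measurableType dW}.
Variables (P : probability W R) (V : probability S R) (k : R.-pker S ~> S).
Variable X : nat -> {RV P >-> S}.
Hypothesis X_markov : markov_chain P V k X.
Context {T : finType} (c : S -> T).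
Hypothesis mc : finite_measurable c.

Let C i w := c (X i w).

(** Makes cylinders admissible as past events in the Markov property. *)
Lemma cylinder_past s n : (size s <= n)%N ->
  g_sigma_preimage (fun i : 'I_n => X i : W -> S) (cylinder C s).
Proof.
set G := g_sigma_preimage _.
elim/last_ind: s => [_|s x IHs].
  rewrite (_ : cylinder _ _ = setT); last by apply/seteqP; split.
  exact: (@measurableT _ (g_sigma_algebraType _)).
rewrite size_rcons => sn; rewrite cylinder_rcons.
apply: (@measurableI _ (g_sigma_algebraType _)); first exact: (IHs (ltnW sn)).
apply: sub_sigma_algebra.
rewrite (bigD1 (Ordinal sn))//=; left.
exists (c @^-1` [set x]); first exact: mc.
by rewrite setTI.
Qed.

(** The discretised chain need not be Markov. However, the Markov property of [X] gives an integral
    over a cylinder on which the last state stays in the cell [x], and there the integrand is almost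
    constant. *)
Lemma markov_cylinder_approx (Pi : probability S R) (p : S -> S -> R)
    (b : T -> T -> R) eps delta s x y :
  (forall x, has_density (k x) Pi (p x)) ->
  (forall x y, `|p x y - 1| <= eps) ->
  (forall z y, `|fine (k z (c @^-1` [set y])) -
     fine (Pi (c @^-1` [set y])) * b (c z) y| <=
     fine (Pi (c @^-1` [set y])) * delta) ->
  `|fine (P (cylinder C (rcons (rcons s x) y))) -
    fine (P (cylinder C (rcons s x))) *
      (fine (Pi (c @^-1` [set y])) * b x y)| <=
  fine (P (cylinder C (rcons s x))) * (fine (Pi (c @^-1` [set y])) * delta).
Proof.
move=> kp p1 kb.
set q := fine (Pi _).
have mC i : finite_measurable (C i) by exact: finite_measurable_RV.
have mE : measurable (cylinder C (rcons s x)) by exact: measurable_cylinder.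
have Ex w : cylinder C (rcons s x) w -> c (X (size s) w) = x.
  by rewrite cylinder_rcons => -[].
have -> : P (cylinder C (rcons (rcons s x) y)) =
    (\int[P]_(w in cylinder C (rcons s x))
      k (X (size s) w) (c @^-1` [set y]))%E.
  rewrite cylinder_rcons size_rcons -(X_markov.2 (size s) _ _ _ (mc y))//.
  by apply: cylinder_past; rewrite size_rcons.
under eq_integral do rewrite -(fineK (kernel_fin kp p1 _ (mc y))).
rewrite [_ * (q * b x y)]mulrC [leRHS]mulrC.
apply: (fine_integral_near P mE _ _).2.
  apply: measurable_funTS.
  apply: (measurableT_comp (f := fun z => fine (k z (c @^-1` [set y])))) => //.
  exact: (measurable_kernel_fine kp p1).
by move=> w /Ex xw; rewrite -xw; exact: kb.
Qed.

End markov_paths.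

Lemma holder_partition (R : realType) (d : measure_display)
    (S : measurableMetricType d R) (beta phi kappa gamma : R)
    (p : S -> S -> R) :
  (@measurable d S = <<s @open S >>) ->
  (forall r : R, 0 < r <= 1 ->
     (covering_number S r <= (phi * r `^ (- beta))%:E)%E) ->
  0 < kappa -> 0 < gamma ->
  (forall x z z' : S, `|p x z - p x z'| <= kappa * (mdist z z') `^ gamma) ->
  forall delta : R, 0 < delta ->
  exists (T : finType) (c : S -> T), finite_measurable c /\
    forall u v, c u = c v -> forall x, `|p x u - p x v| <= delta.
Proof.
move=> borel cov kappa0 gamma0 hold delta delta0.
(* The distance at which the Hölder bound equals [delta]; below, [r] is also capped at 1 because the
   covering bound is available only there. *)
pose t := (delta / kappa) `^ gamma^-1.
have t0 : 0 < t by rewrite powR_gt0// divr_gt0.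
pose r := Num.min 1 (t / 2).
have r01 : 0 < r <= 1 by rewrite /r lt_min ltr01 divr_gt0//= ge_min lexx.
have [T [c [mc cuv]]] := covering_partition borel (cov r r01).
exists T, c; split=> // u v /cuv uv x.
rewrite (le_trans (hold x u v))// mulrC -ler_pdivlMr//.
have -> : delta / kappa = t `^ gamma.
  by rewrite /t -powRrM mulVf ?gt_eqF// powRr1// divr_ge0// ltW.
apply: ge0_ler_powR; rewrite ?nnegrE ?mdist_ge0//; try exact: ltW.
rewrite (le_trans (ltW uv))// mulrC -ler_pdivlMr//.
by rewrite /r ge_min lexx orbT.
Qed.

(** * Comparison of the two path laws *)

Section comparison.
Context {R : realType} {d : measure_display} {S : measurableType d}.
Variables (V Pi : probability S R) (k : R.-pker S ~> S).
Variables (nu : S -> R) (p : S -> S -> R) (eps : R).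
Context {dX dY : measure_display} {WX : measurableType dX}
  {WY : measurableType dY}.
Variables (PX : probability WX R) (X : nat -> {RV PX >-> S}).
Variables (PY : probability WY R) (Y : nat -> {RV PY >-> S}).
Hypothesis X_markov : markov_chain PX V k X.
Hypothesis Y_iid : iid PY Pi Y.
Hypothesis k_invariant : Defs.invariant k Pi.
Hypothesis V_density : has_density V Pi nu.
Hypothesis k_density : forall x, has_density (k x) Pi (p x).
Hypothesis eps_gt0 : 0 < eps.
Hypothesis eps_half : eps <= 2^-1.
Hypothesis p_near1 : forall x y, `|p x y - 1| <= eps.
Hypothesis nu_near1 : forall x, `|nu x - 1| <= eps.
Hypothesis p_partition : forall delta : R, 0 < delta ->
  exists (T : finType) (c : S -> T), finite_measurable c /\
    forall u v, c u = c v -> forall x, `|p x u - p x v| <= delta.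

Lemma path_law_close_steady (T : finType) (c : S -> T) (delta : R)
    (D : pred (seq T)) n : 0 <= delta -> finite_measurable c ->
  kernel_steady Pi k delta c -> seq_symmetric D ->
  `|fine (PX [set w | D (path_of (fun i w => c (X i w)) n.+1 w)]) -
    fine (PY [set w | D (path_of (fun i w => c (Y i w)) n.+1 w)])| <=
  289 * eps + n%:R * delta.
Proof.
move=> delta0 mc cst DS.
have e0 := ltW eps_gt0.
pose pi x := fine (Pi (c @^-1` [set x])).
have pi0 x : 0 <= pi x by exact: fine_ge0.
have pi1 : \sum_x pi x = 1 by exact: fine_fibers_sum1.
pose b := averaged_kernel Pi k c.
pose h x y := (b x y - 1) / eps.
have bE x y : b x y = 1 + eps * h x y.
  by rewrite /h mulrCA mulfV ?gt_eqF// mulr1; ring.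
have b_row x : \sum_y pi y * b x y = 1.
  exact: (averaged_kernel_row k_density p_near1).
have b_col y : \sum_x pi x * b x y = 1.
  exact: (averaged_kernel_col k_density p_near1).
have b1 x y : `|b x y - 1| <= eps.
  exact: (averaged_kernel_near1 k_density p_near1).
have hD : degenerate pi h.
  split=> [x y|x|y].
  - by rewrite /h normrM normfV (gtr0_norm eps_gt0) ler_pdivrMr// mul1r.
  - under eq_bigr do rewrite /h mulrA mulrBr mulr1.
    by rewrite -mulr_suml sumrB b_row pi1 subrr mul0r.
  - under eq_bigr do rewrite /h mulrA mulrBr mulr1.
    by rewrite -mulr_suml sumrB b_col pi1 subrr mul0r.
have b_ge0 x y : 0 <= b x y.
  have := b1 x y; rewrite ler_norml => /andP[+ _].
  by move: (b x y) eps_half => z ? ?; lra.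
have mX i : finite_measurable (fun w => c (X i w)).
  exact: finite_measurable_RV.
have kb z y :
    `|fine (k z (c @^-1` [set y])) - pi y * b (c z) y| <= pi y * delta.
  exact: (averaged_kernel_approx k_density p_near1).
rewrite (iid_path_law Y_iid mc).
(* The initial density averaged over each cell; the value 1 on null cells keeps it within [eps] of 1
   everywhere. *)
pose g x := if pi x == 0 then 1 else fine (V (c @^-1` [set x])) / pi x.
have Vnear x : `|fine (V (c @^-1` [set x])) - pi x| <= eps * pi x.
  have [mnu VE] := V_density; rewrite VE//.
  rewrite -[X in _ - X]mul1r.
  by apply: (fine_integral_near Pi (mc x) _ _).2 => //; exact: measurable_funTS.
have gE x : fine (PX ((fun w => c (X 0%N w)) @^-1` [set x])) = pi x * g x.
  have -> : PX ((fun w => c (X 0%N w)) @^-1` [set x]) = V (c @^-1` [set x]).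
    by rewrite -X_markov.1.
  rewrite /g; case: ifPn => [/eqP x0|x0]; last by rewrite mulrCA mulfV// mulr1.
  by have := Vnear x; rewrite x0 mulr0 subr0 mul0r normr_le0 => /eqP.
have g1 x : `|g x - 1| <= eps.
  rewrite /g; case: ifPn => [_|x0]; first by rewrite subrr normr0.
  have {}x0 : 0 < pi x by rewrite lt_def x0 pi0.
  rewrite -(ler_pM2r x0) -[X in _ * X <= _](gtr0_norm x0) -normrM mulrBl mul1r.
  by rewrite divfK ?gt_eqF.
have A1 := path_of_approx mX pi0 pi1 b_ge0 b_row
  (fun s x y => markov_cylinder_approx X_markov mc s x y k_density p_near1 kb)
  n D delta0.
have A2 : `|\sum_x pi x * g x *
      markovE pi b n x (fun s => (D (x :: s))%:R) -
    iidE pi n.+1 (fun s => (D s)%:R)| <= 289 * eps.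
  apply: (markovE_iidE_bound pi0 pi1 eps_gt0 eps_half hD bE n _ _ g1
    (phi := fun s => (D s)%:R)) => [s t st|s].
    by rewrite (DS s t st).
  by case: (D s); rewrite ?normr1 ?normr0.
move: A2; under eq_bigr => x _ do rewrite -gE.
move=> A2.
rewrite [leRHS]addrC; apply: (le_trans _ (lerD A1 A2)).
exact: ler_distD.
Qed.

(** Refining the partition makes [delta] arbitrarily small while the event, pulled back along [g],
    stays the same. Hence the discretisation error disappears in the limit. *)
Lemma path_law_close (T : finType) (c : S -> T) (D : pred (seq T)) n :
  finite_measurable c -> seq_symmetric D ->
  `|fine (PX [set w | D (path_of (fun i w => c (X i w)) n.+1 w)]) -
    fine (PY [set w | D (path_of (fun i w => c (Y i w)) n.+1 w)])| <=
  289 * eps.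
Proof.
move=> mc DS; apply/ler_addgt0Pr => e e0.
have e0' : 0 < e / n.+1%:R by rewrite divr_gt0.
have [|T' [c' [g [mc' cg ste]]]] :=
  kernel_steady_refinement k_density p_near1 _ p_partition e0' mc.
  by rewrite (le_trans eps_half)// invf_le1// ler1n.
have E dW (W : measurableType dW) (Z : nat -> W -> S) :
    [set w | D (path_of (fun i w => c (Z i w)) n.+1 w)] =
    [set w | D (map g (path_of (fun i w => c' (Z i w)) n.+1 w))].
  have PE w : path_of (fun i w => c (Z i w)) n.+1 w =
      map g (path_of (fun i w => c' (Z i w)) n.+1 w).
    by rewrite /path_of /mkseq -map_comp; apply: eq_map => i /=; rewrite cg.
  by apply/seteqP; split => w; rewrite /mkset PE.
rewrite (E _ WX (fun i => X i : WX -> S)) (E _ WY (fun i => Y i : WY -> S)).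
have := @path_law_close_steady T' c' (e / n.+1%:R) (fun s => D (map g s)) n.
move=> /(_ (ltW e0') mc' ste) /(_ (fun s t st => DS _ _ (perm_map g st))).
move=> /le_trans; apply; rewrite lerD2l mulrCA ler_piMr ?(ltW e0)//.
by rewrite ler_pdivrMr// mul1r ler_nat.
Qed.

End comparison.

(** * Approximation of events on the local time field *)

Section close_events.
Context {R : realType} {d : measure_display} {W : measurableType d}.
Variable P : probability W R.
Local Open Scope ereal_scope.

Definition close_events (e : R) (U U' : set W) :=
  P (U `\` U') <= e%:E /\ P (U' `\` U) <= e%:E.

Lemma close_events_refl e U : (0 <= e)%R -> close_events e U U.
Proof. by move=> e0; split; rewrite setDv measure0 lee_fin. Qed.

Lemma close_eventsC e U U' : close_events e U U' ->
  close_events e (~` U) (~` U').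
Proof. by move=> [h1 h2]; split; rewrite setDE setCK setIC -setDE. Qed.

Let measure_leD A B C e e' : measurable A -> measurable B -> measurable C ->
  A `<=` B `|` C -> P B <= e%:E -> P C <= e'%:E -> P A <= (e + e')%:E.
Proof.
move=> mA mB mC ABC Be Ce'.
rewrite (le_trans (le_measure P _ _ ABC)) ?inE//; first exact: measurableU.
by rewrite (le_trans (measureU2 P mB mC))// EFinD leeD.
Qed.

Lemma close_eventsU e e' U1 U2 V1 V2 :
  measurable U1 -> measurable U2 -> measurable V1 -> measurable V2 ->
  close_events e U1 V1 -> close_events e' U2 V2 ->
  close_events (e + e') (U1 `|` U2) (V1 `|` V2).
Proof.
move=> mU1 mU2 mV1 mV2 [h1 h1'] [h2 h2']; split.
  apply: measure_leD h1 h2; [|exact: measurableD..|].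
    by apply: measurableD; exact: measurableU.
  by move=> w [[?|?] /not_orP[? ?]]; [left|right].
apply: measure_leD h1' h2'; [|exact: measurableD..|].
  by apply: measurableD; exact: measurableU.
by move=> w [[?|?] /not_orP[? ?]]; [left|right].
Qed.

Lemma close_events_trans e e' U1 U2 U3 :
  measurable U1 -> measurable U2 -> measurable U3 ->
  close_events e U1 U2 -> close_events e' U2 U3 ->
  close_events (e + e') U1 U3.
Proof.
move=> m1 m2 m3 [h1 h1'] [h2 h2']; split.
  apply: measure_leD h1 h2; try exact: measurableD.
  by move=> w [? ?]; have [?|?] := pselect (U2 w); [right|left].
rewrite addrC; apply: measure_leD h2' h1'; try exact: measurableD.
by move=> w [? ?]; have [?|?] := pselect (U2 w); [right|left].
Qed.

Lemma close_events_fine e U U' : measurable U -> measurable U' ->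
  close_events e U U' -> (`|fine (P U) - fine (P U')| <= e)%R.
Proof.
move=> mU mU' [h1 h2].
have UE A B : measurable A -> measurable B -> P (A `\` B) <= e%:E ->
    (fine (P A) <= fine (P B) + e)%R.
  move=> mA mB ABe; rewrite -lee_fin EFinD !fineK ?fin_num_measure//.
  rewrite (@le_trans _ _ (P (B `|` (A `\` B))))//.
    rewrite le_measure ?inE//; first exact/measurableU/measurableD.
    by move=> w Aw; have [?|?] := pselect (B w); [left|right].
  by rewrite (le_trans (measureU2 P mB (measurableD mA mB)))// leeD2l.
have := UE _ _ mU mU' h1; have := UE _ _ mU' mU h2.
by rewrite ler_norml => ? ?; apply/andP; split; lra.
Qed.

(** Continuity from above along the decreasing remainders. It holds for all large [m], so that two
    probability measures can share one [m]. *)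
Lemma close_events_bigcup (U : nat -> set W) (e : R) : (0 < e)%R ->
  (forall i, measurable (U i)) ->
  \forall m \near \oo,
    close_events e (\bigcup_i U i) (\big[setU/set0]_(i < m) U i).
Proof.
move=> e0 mU; pose F m := \bigcup_i U i `\` \big[setU/set0]_(i < m) U i.
have mF m : measurable (F m).
  by apply: measurableD; [exact: bigcup_measurable|exact: bigsetU_measurable].
have F0 : \bigcap_m F m = set0.
  rewrite -subset0 => w Fw; have [[i _ Uiw] _] := Fw 0%N Logic.I.
  have [_] := Fw i.+1 Logic.I; apply.
  by rewrite big_ord_recr/=; right.
have : P \o F @ \oo --> P (\bigcap_m F m).
  apply: nonincreasing_cvg_mu => //.
  - by rewrite ltey_eq fin_num_measure.
  - by rewrite F0.
  - move=> m m' mm'; apply/subsetPset; apply: setDS.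
    exact: subset_bigsetU.
rewrite F0 measure0 => /fine_cvgP[_] /cvgr_lt /(_ _ e0) h.
near=> m; split.
  rewrite -(fineK (fin_num_measure P _ (mF m))) lee_fin ltW//.
  by near: m.
rewrite (_ : _ `\` _ = set0) ?measure0 ?lee_fin ?ltW//.
rewrite setD_eq0; exact: bigsetU_bigcup.
Unshelve. all: by end_near.
Qed.

End close_events.

Section path_events.
Context {R : realType} {d : measure_display} {S : measurableType d}.
Context {dX dY : measure_display} {WX : measurableType dX}
  {WY : measurableType dY}.
Variables (PX : probability WX R) (X : nat -> {RV PX >-> S}).
Variables (PY : probability WY R) (Y : nat -> {RV PY >-> S}).
Variable n : nat.

Definition path_event {dW} {W : measurableType dW} {P : probability W R}
    (Z : nat -> {RV P >-> S}) {T : finType} (c : S -> T) (D : pred (seq T)) :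
    set W :=
  [set w | D (path_of (fun i w => c (Z i w)) n w)].

(** One partition and one symmetric [D] serve both processes, since the comparison of path laws
    concerns a common event. *)
Definition path_approximable (A : set (point_measure_space S R n)) :=
  measurable A /\ forall e : R, 0 < e ->
  exists (T : finType) (c : S -> T) (D : pred (seq T)),
    [/\ finite_measurable c, seq_symmetric D,
        close_events PX e (local_time n X @^-1` A) (path_event X c D) &
        close_events PY e (local_time n Y @^-1` A) (path_event Y c D)].

Lemma measurable_path_event {dW} {W : measurableType dW} {P : probability W R}
    (Z : nat -> {RV P >-> S}) {T : finType} (c : S -> T) (D : pred (seq T)) :
  finite_measurable c -> measurable (path_event Z c D).
Proof.
move=> mc; apply: (measurable_path_of _ n [set s | D s]) => i.
exact: finite_measurable_RV.
Qed.

Lemma measurable_local_time_preimage {dW} {W : measurableType dW}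
    {P : probability W R} (Z : nat -> {RV P >-> S})
    (A : set (point_measure_space S R n)) :
  measurable A -> measurable (local_time n Z @^-1` A).
Proof. exact: measurable_funPTI. Qed.

Lemma path_approximable0 : path_approximable set0.
Proof.
split=> // e e0; exists unit, (fun=> tt), xpred0; split => //.
- move=> t; rewrite (_ : _ @^-1` _ = setT)//.
  by apply/seteqP; split => // x _ /=; case: t.
- rewrite preimage_set0 (_ : path_event _ _ _ = set0).
    exact: close_events_refl (ltW e0).
  by apply/seteqP; split.
- rewrite preimage_set0 (_ : path_event _ _ _ = set0).
    exact: close_events_refl (ltW e0).
  by apply/seteqP; split.
Qed.

Lemma path_approximableC A : path_approximable A -> path_approximable (~` A).
Proof.
move=> [mA hA]; split=> [|e e0]; first exact: measurableC.
have [T [c [D [mc DS cX cY]]]] := hA e e0.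
exists T, c, (fun s => ~~ D s); split=> //.
- by move=> s t st; rewrite (DS _ _ st).
- rewrite (_ : path_event _ _ _ = ~` path_event X c D).
    exact: close_eventsC.
  by apply/seteqP; split => w /negP.
- rewrite (_ : path_event _ _ _ = ~` path_event Y c D).
    exact: close_eventsC.
  by apply/seteqP; split => w /negP.
Qed.

(** Pairing the two partitions gives a common refinement, through which each event is read by a
    projection. *)
Lemma path_eventU {dW} {W : measurableType dW} {P : probability W R}
    (Z : nat -> {RV P >-> S}) {T T' : finType} (c : S -> T) (c' : S -> T')
    (D : pred (seq T)) (D' : pred (seq T')) :
  path_event Z (fun x => (c x, c' x))
    (fun s => D (unzip1 s) || D' (unzip2 s)) =
  path_event Z c D `|` path_event Z c' D'.
Proof.
have p1 w : unzip1 (path_of (fun i w => (c (Z i w), c' (Z i w))) n w) =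
    path_of (fun i w => c (Z i w)) n w.
  by rewrite /unzip1/path_of/mkseq -map_comp.
have p2 w : unzip2 (path_of (fun i w => (c (Z i w), c' (Z i w))) n w) =
    path_of (fun i w => c' (Z i w)) n w.
  by rewrite /unzip2/path_of/mkseq -map_comp.
apply/seteqP; split => w; rewrite /path_event /mkset/= p1 p2.
  by move=> /orP[?|?]; [left|right].
by move=> ?; apply/orP.
Qed.

Lemma path_approximableU A B : path_approximable A -> path_approximable B ->
  path_approximable (A `|` B).
Proof.
move=> [mA hA] [mB hB]; split=> [|e e0]; first exact: measurableU.
have e20 : 0 < e / 2 by rewrite divr_gt0.
have [T [c [D [mc DS cX cY]]]] := hA _ e20.
have [T' [c' [D' [mc' DS' cX' cY']]]] := hB _ e20.
exists _, (fun x => (c x, c' x)), (fun s => D (unzip1 s) || D' (unzip2 s)).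
split.
- exact: finite_measurable_pair.
- move=> s t st.
  by rewrite (DS _ _ (perm_map fst st)) (DS' _ _ (perm_map snd st)).
- rewrite preimage_setU path_eventU [e]splitr.
  by apply: close_eventsU => //; first [exact: measurable_local_time_preimage
    |exact: measurable_path_event].
- rewrite preimage_setU path_eventU [e]splitr.
  by apply: close_eventsU => //; first [exact: measurable_local_time_preimage
    |exact: measurable_path_event].
Qed.

(** Half of the error goes to truncating the union, half to approximating the finite union. *)
Lemma path_approximable_bigcup (A : nat -> set (point_measure_space S R n)) :
  (forall i, path_approximable (A i)) -> path_approximable (\bigcup_i A i).
Proof.
move=> hA; split=> [|e e0].
  by apply: bigcup_measurable => i _; exact: (hA i).1.
have e20 : 0 < e / 2 by rewrite divr_gt0.
have mX i : measurable (local_time n X @^-1` A i).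
  by apply: measurable_local_time_preimage; exact: (hA i).1.
have mY i : measurable (local_time n Y @^-1` A i).
  by apply: measurable_local_time_preimage; exact: (hA i).1.
have hB m : path_approximable (\big[setU/set0]_(i < m) A i).
  elim: m => [|m IHm]; first by rewrite big_ord0; exact: path_approximable0.
  by rewrite big_ord_recr; exact: path_approximableU.
have [m [cX0 cY0]] : exists m,
    close_events PX (e / 2) (\bigcup_i (local_time n X @^-1` A i))
      (\big[setU/set0]_(i < m) (local_time n X @^-1` A i)) /\
    close_events PY (e / 2) (\bigcup_i (local_time n Y @^-1` A i))
      (\big[setU/set0]_(i < m) (local_time n Y @^-1` A i)).
  near \oo => m; exists m; split; near: m; exact: close_events_bigcup.
have [T [c [D [mc DS cX cY]]]] := (hB m).2 _ e20.
have pre (dW : measure_display) (W : measurableType dW) (P : probability W R)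
    (Z : nat -> {RV P >-> S}) :
  local_time n Z @^-1` (\big[setU/set0]_(i < m) A i) =
  \big[setU/set0]_(i < m) (local_time n Z @^-1` A i).
  elim: (m) => [|j IHj]; first by rewrite !big_ord0 preimage_set0.
  by rewrite !big_ord_recr/= preimage_setU IHj.
exists T, c, D; split => //.
- rewrite preimage_bigcup [e]splitr; move: cX; rewrite pre => cX.
  apply: (close_events_trans _ _ _ cX0 cX).
  + by apply: bigcup_measurable => i _; exact: mX.
  + by apply: bigsetU_measurable => i _; exact: mX.
  + exact: measurable_path_event.
- rewrite preimage_bigcup [e]splitr; move: cY; rewrite pre => cY.
  apply: (close_events_trans _ _ _ cY0 cY).
  + by apply: bigcup_measurable => i _; exact: mY.
  + by apply: bigsetU_measurable => i _; exact: mY.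
  + exact: measurable_path_event.
Unshelve. all: by end_near.
Qed.

Lemma local_time_count {dW} {W : measurableType dW} {P : probability W R}
    (Z : nat -> {RV P >-> S}) (B : set S) w :
  (local_time n Z w : point_measure S R n) B =
  (count id (path_of (fun i w => Z i w \in B) n w))%:R%:E.
Proof.
rewrite /local_time /= /msum/=.
under eq_bigr do rewrite diracE.
rewrite sumEFin -natr_sum; congr (_%:R%:E).
rewrite -sum1_count [RHS]big_mkcond big_map /path_of.
rewrite (_ : iota 0 n = index_iota 0 n); last by rewrite /index_iota subn0.
by rewrite big_mkord; apply: eq_bigr => i _; case: (_ \in B).
Qed.

(** The number of points in [B] is a symmetric function of the path seen through the two cells [B]
    and its complement, so no error arises. *)
Lemma path_approximable_evaluation (B : set S) (E : set (\bar R)) :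
  measurable B -> measurable E ->
  path_approximable [set m : point_measure S R n | E (m B)].
Proof.
move=> mB mE; split=> [|e e0].
  apply: sub_sigma_algebra; exists B => //; exists E => //.
  by rewrite setTI.
have pE (dW : measure_display) (W : measurableType dW) (P : probability W R)
    (Z : nat -> {RV P >-> S}) :
  local_time n Z @^-1` [set m : point_measure S R n | E (m B)] =
  path_event Z (fun x => x \in B)
    (fun s => `[< E ((count id s)%:R%:E) >]).
  apply/seteqP; split => w; rewrite /path_event /=.
    by move=> h; apply/asboolP; rewrite -local_time_count.
  by move=> /asboolP; rewrite -local_time_count.
exists bool, (fun x => x \in B), (fun s => `[< E ((count id s)%:R%:E) >]).
split.
- move=> b; rewrite (_ : _ @^-1` _ = if b then B else ~` B).
    by case: b => //; exact: measurableC.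
  apply/seteqP; split => x /=; case: b.
  + by move/set_mem.
  + by move=> xB Bx; move: xB; rewrite mem_set.
  + by move/mem_set.
  + by move=> nB; apply/negbTE; apply/negP => /set_mem.
- by move=> s t /permP st; rewrite st.
- by rewrite pE; exact: close_events_refl (ltW e0).
- by rewrite pE; exact: close_events_refl (ltW e0).
Qed.

(** The approximable sets form a sigma-algebra containing the generators. *)
Lemma measurable_path_approximable (A : set (point_measure_space S R n)) :
  measurable A -> path_approximable A.
Proof.
apply: smallest_sub; last first.
  move=> _ [B mB [E mE <-]]; rewrite setTI.
  exact: path_approximable_evaluation.
split.
- exact: path_approximable0.
- by move=> B hB; rewrite setTD; exact: path_approximableC.
- by move=> B hB; exact: path_approximable_bigcup.
Qed.

End path_events.

(** * Total variation distance of the local time fields *)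

Theorem theorem2p4 (R : realType) :
  exists K : R, 0 < K /\
  forall (d : measure_display) (S : measurableMetricType d R)
    (beta phi : R)
    (V Pi : probability S R) (k : R.-pker S ~> S)
    (nu : S -> R) (p : S -> S -> R) (kappa gamma eps : R)
    (dX : measure_display) (WX : measurableType dX) (PX : probability WX R)
    (X : nat -> {RV PX >-> S})
    (dY : measure_display) (WY : measurableType dY) (PY : probability WY R)
    (Y : nat -> {RV PY >-> S}),
  compact [set: S] ->
  (@measurable d S = <<s @open S >>) ->
  0 <= beta -> 1 <= phi ->
  (forall r : R, 0 < r <= 1 ->
     (covering_number S r <= (phi * r `^ (- beta))%:E)%E) ->
  markov_chain PX V k X ->
  unique_invariant k Pi ->
  has_density V Pi nu ->
  (forall x, has_density (k x) Pi (p x)) ->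
  0 < kappa -> 0 < gamma <= 1 ->
  (forall x z z' : S, `|p x z - p x z'| <= kappa * (mdist z z') `^ gamma) ->
  0 < eps <= 2^-1 ->
  (forall x y : S, `|p x y - 1| <= eps) ->
  (forall x : S, `|nu x - 1| <= eps) ->
  iid PY Pi Y ->
  forall n : nat, (1 <= n)%N ->
  (dTV PX (local_time n X) PY (local_time n Y) <=
   (K * eps * Num.sqrt (1 + ln (phi * 2 `^ beta)
      + beta / gamma * ln (Num.max kappa (2 * eps) / eps)))%:E)%E.
Proof.
exists 289; split=> // d S beta phi V Pi k nu p kappa gamma eps dX WX PX X dY WY
  PY Y _ borel beta0 phi1 cov X_markov [k_inv _] V_dens k_dens kappa0
  /andP[gamma0 _] hold /andP[eps0 eps_half] p1 nu1 Y_iid [//|n] _.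
have part := holder_partition borel cov kappa0 gamma0 hold.
set s := Num.sqrt _.
(* Both logarithms have arguments at least 1; for the second this is due to the maximum with
   [2 * eps]. *)
have s1 : 1 <= s.
  have L1 : 0 <= ln (phi * 2 `^ beta).
    rewrite ln_ge0// mulr_ege1// -[leLHS](powRr0 2).
    by apply: ler_powR => //; rewrite ler1n.
  have L2 : 0 <= ln (Num.max kappa (2 * eps) / eps).
    rewrite ln_ge0// ler_pdivlMr// mul1r le_max; apply/orP; right.
    by rewrite ler_peMl ?ltW// ltr1n.
  rewrite -[leLHS]sqrtr1 ler_wsqrtr// -addrA lerDl addr_ge0// mulr_ge0//.
  by rewrite divr_ge0// ltW.
apply: ge_ereal_sup => _ [A mA <-].
have [_ hA] := measurable_path_approximable X Y mA.
have mLX := measurable_local_time_preimage X mA.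
have mLY := measurable_local_time_preimage Y mA.
rewrite /distribution /pushforward.
rewrite -(fineK (fin_num_measure PX _ mLX)) -(fineK (fin_num_measure PY _ mLY)).
rewrite -EFinB abse_EFin lee_fin.
apply: (@le_trans _ _ (289 * eps)); last by rewrite ler_peMr// mulr_ge0// ltW.
apply/ler_addgt0Pr => e e0.
(* Each process gets [e / 2] for approximating its event. *)
have [T [c [D [mc DS cX cY]]]] := hA _ (divr_gt0 e0 (ltr0n R 2)).
have aX := close_events_fine mLX (measurable_path_event n.+1 X D mc) cX.
have aY := close_events_fine mLY (measurable_path_event n.+1 Y D mc) cY.
have XY := path_law_close X_markov Y_iid k_inv V_dens k_dens eps0 eps_half p1
  nu1 part n mc DS.
move: aX aY XY; rewrite /path_event [in _ -> _ -> _]/=.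
move: (fine _) (fine _) (fine _) (fine _) => x x' y y'.
rewrite !ler_norml => /andP[? ?] /andP[? ?] /andP[? ?].
by apply/andP; split; lra.
Qed.
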